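(* Let $t\in\mathbb{N}$ and $Q\subseteq\wp(\mathbb{N}^t)$. The state semantics $\langle Q,=\rangle$ of basic affine control flow graphs is strong smn (with respect to the URM concrete semantics $\phi$), branching and discharging.
   Context: URMs (Cutland) with a fixed Gödel numbering $RM_a$; the concrete semantics is $\phi_a^{(n)}(\vec x)=y$ if $RM_a$ started with $\vec x$ in its first $n$ registers (others $0$) halts with $y$ in register $1$, and undefined otherwise. A basic affine control flow graph (BACFG) is $G=(N,E,s,e)$ with finite node set $N$, start/end nodes $s,e$, edges $E\subseteq N\times\mathrm{Com}\times N$ labelled by assignments $x_i:=0$, $x_i:=x_j$, $x_i:=x_j+1$ or guards $x_i=x_j?$, $x_i=v?$ ($v\in\mathbb{N}$); fix an effective Gödel numbering $G_a=(N_a,E_a,s_a,e_a)$ of all BACFGs. For input $\vec x\in\mathbb{N}^{n}$, states are tuples in $\mathbb{N}^k$ with $k$ the maximum of $n$ and the largest variable index of $G$; transfer functions $f_c$ apply the assignment to each state or keep the states satisfying the guard. For $S\subseteq\mathbb{N}^{k'}$, $S\restriction_k$ is $S\times\mathbb{N}^{k-k'}$ if $k'<k$, $S$ if $k'=k$, and the projections onto the first $k$ coordinates if $k<k'$. The collecting semantics $[\![G]\!]_{\vec x}:N\to\wp(\mathbb{N}^k)$ is the least assignment with $[\![G]\!]_{\vec x}[s]\supseteq\{\vec x\}\restriction_k$ and $[\![G]\!]_{\vec x}[v]\supseteq f_c([\![G]\!]_{\vec x}[u])$ for all $(u,c,v)\in E$. The state semantics: $Q_a^{(n)}(\vec x)=1$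 if $[\![G_a]\!]_{\vec x}[e_a]\neq\varnothing$ and $[\![G_a]\!]_{\vec x}[e_a]\restriction_t\in Q$; $=0$ if $[\![G_a]\!]_{\vec x}[e_a]\neq\varnothing$ and $[\![G_a]\!]_{\vec x}[e_a]\restriction_t\notin Q$; undefined if $[\![G_a]\!]_{\vec x}[e_a]=\varnothing$; functions are compared by equality. For an abstract semantics $\langle\pi,\equiv_\pi\rangle$ (here $\pi=Q$, $\equiv_\pi$ is $=$): strong smn means for all $m,n\ge1$ there is a total computable $s:\mathbb{N}^{m+2}\to\mathbb{N}$ with $\lambda\vec y.\,\pi_a^{(n+1)}(\phi_b^{(m)}(\vec x),\vec y)\equiv_\pi\pi_{s(a,b,\vec x)}^{(n)}$ for all $a,b,\vec x$; branching means for every $n\ge1$ there is a total computable $r:\mathbb{N}^4\to\mathbb{N}$ such that for all $a,b,c_1,c_2,x$ with $c_1\ne c_2$, $\lambda\vec y.\,\pi^{(n)}_{r(a,b,c_1,c_2)}(x,\vec y)$ is $\equiv_\pi$ to $\lambda\vec y.\,\pi_a^{(n)}(x,\vec y)$ if $x=c_1$, to $\lambda\vec y.\,\pi_b^{(n)}(x,\vec y)$ if $x=c_2$, and to the everywhere undefined function otherwise; discharging means for every $n\ge1$ there is a total computable $t':\mathbb{N}\to\mathbb{N}$ with $\pi_a^{(n)}\equiv_\pi\lambda\vec y.\,\pi_{t'(a)}^{(n+1)}(x,\vec y)$ for all $a,x$. *)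

(* Defs.v *)
From HB Require Import structures.
From mathcomp Require Import all_boot.
From mathcomp Require Import zmodp.
From mathcomp Require Import boolp classical_sets.

Set Implicit Arguments.
Unset Strict Implicit.
Unset Printing Implicit Defensive.

Local Open Scope classical_set_scope.
Local Open Scope nat_scope.

(* [None] is "undefined", so Leibniz equality on [pfun n] is equality of
   partial functions. *)
Definition pfun (n : nat) := n.-tuple nat -> option nat.

(* Cutland's bijection N * N -> N, (m, n) |-> 2^m (2n + 1) - 1. *)
Definition npair (m n : nat) : nat := (2 ^ m * n.*2.+1).-1.

Definition nunpair (z : nat) : nat * nat :=
  let m := logn 2 z.+1 in (m, (z.+1 %/ 2 ^ m)./2).

Lemma npairK m n : nunpair (npair m n) = (m, n).
Proof.
rewrite /nunpair /npair prednK ?muln_gt0 ?expn_gt0 //.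
rewrite lognM ?expn_gt0 // pfactorK // lognE /= dvdn2 /= odd_double addn0.
by rewrite mulKn ?expn_gt0 //= uphalf_double.
Qed.

Lemma nunpairK z : npair (nunpair z).1 (nunpair z).2 = z.
Proof.
rewrite /nunpair /npair /=.
have [q ndvd eq_z] := pfactor_coprime (isT : prime 2) (ltn0Sn z).
have odd_q : odd q by rewrite coprime2n in ndvd.
rewrite {2}eq_z mulnK ?expn_gt0 //.
have -> : (q./2).*2.+1 = q by rewrite -[RHS]odd_double_half odd_q.
by rewrite mulnC -eq_z.
Qed.

(* Registers and instructions of a URM are numbered from 0: the register
   R_(i+1) is [i] and the instruction I_(q+1) is [q]. *)
Inductive instr :=
| Zero of nat
| Succ of nat
| Transfer of nat & nat        (* [Transfer m n]: the content of m goes to n *)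
| Jump of nat & nat & nat.

Definition program := seq instr.

Definition regs := nat -> nat.

Definition upd (r : regs) (i v : nat) : regs :=
  fun j => if j == i then v else r j.

Definition config : Type := nat * regs.

Definition step (p : program) (c : config) : config :=
  let: (pc, r) := c in
  match onth p pc with
  | None => c
  | Some (Zero n) => (pc.+1, upd r n 0)
  | Some (Succ n) => (pc.+1, upd r n (r n).+1)
  | Some (Transfer m n) => (pc.+1, upd r n (r m))
  | Some (Jump m n q) => (if r m == r n then q else pc.+1, r)
  end.

Definition halted (p : program) (c : config) : bool := size p <= c.1.

Definition init n (x : n.-tuple nat) : config := (0, fun i => nth 0 x i).

Definition run (p : program) n (x : n.-tuple nat) (k : nat) : config :=
  iter k (step p) (init x).

Definition urm_fun (p : program) n : pfun n := fun x =>
  match pselect (exists k, halted p (run p x k)) with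
  | left h => Some ((run p x (ex_minn h)).2 0)
  | right _ => None
  end.

(* Cutland's codes: Z(n), S(n), T(m,n), J(m,n,q) are 4n, 4n+1, 4<m,n>+2 and
   4<<m,n>,q>+3 (with the indices from 0), and I_1 ... I_s with codes
   a_1, ..., a_s is 2^a_1 + 2^(a_1+a_2+1) + ... + 2^(a_1+...+a_s+s-1) - 1,
   that is, [(CodeSeq.code [:: a_1; ...; a_s]).-1]. *)
Definition instr_code (i : instr) : nat :=
  match i with
  | Zero n => 4 * n
  | Succ n => 4 * n + 1
  | Transfer m n => 4 * npair m n + 2
  | Jump m n q => 4 * npair (npair m n) q + 3
  end.

Definition instr_decode (z : nat) : instr :=
  let w := z %/ 4 in
  match z %% 4 with
  | 0 => Zero w
  | 1 => Succ w
  | 2 => let: (m, n) := nunpair w in Transfer m n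
  | _ => let: (mn, q) := nunpair w in let: (m, n) := nunpair mn in Jump m n q
  end.

Lemma instr_codeK : cancel instr_code instr_decode.
Proof.
case=> [n|n|m n|m n q]; rewrite /instr_decode /instr_code mulnC.
- by rewrite modnMl mulnK.
- by rewrite modnMDl divnMDl // addn0.
- by rewrite modnMDl divnMDl // addn0 npairK.
- by rewrite modnMDl divnMDl // addn0 npairK npairK.
Qed.

Lemma instr_decodeK : cancel instr_decode instr_code.
Proof.
move=> z; rewrite [RHS](divn_eq z 4) mulnC /instr_decode.
have := ltn_pmod z (isT : 0 < 4); have := nunpairK (z %/ 4).
case: (nunpair (z %/ 4)) => m n; rewrite [(_, _).1]/= [(_, _).2]/= => eq_w.
have := nunpairK m; case: (nunpair m) => i j; rewrite [(_, _).1]/= [(_, _).2]/=.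
case: (z %% 4) => [|[|[|[|]]]] // eq_m _; rewrite -eq_w ?addn0 //.
by rewrite -eq_m.
Qed.

Definition program_code (p : program) : nat :=
  (CodeSeq.code (map instr_code p)).-1.

Definition RM (a : nat) : program := map instr_decode (CodeSeq.decode a.+1).

Lemma program_codeK p : 0 < size p -> RM (program_code p) = p.
Proof.
move=> p_gt0; rewrite /RM /program_code prednK ?CodeSeq.codeK.
  exact: mapK instr_codeK p.
by case: p p_gt0 => //= i p _; rewrite muln_gt0 expn_gt0.
Qed.

Lemma RMK : cancel RM program_code.
Proof.
by move=> a; rewrite /program_code (mapK instr_decodeK) CodeSeq.decodeK.
Qed.

Definition phi n (a : nat) : pfun n := @urm_fun (RM a) n.
Arguments phi : clear implicits.

Definition computable n (f : n.-tuple nat -> nat) : Prop :=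
  exists a, forall x, phi n a x = Some (f x).

(* Variables are numbered from 0: the variable x_(i+1) is [i]. *)
Inductive com :=
| AssignZero (i : nat)         (* x_i := 0 *)
| AssignVar (i j : nat)        (* x_i := x_j *)
| AssignSucc (i j : nat)       (* x_i := x_j + 1 *)
| GuardVar (i j : nat)         (* x_i = x_j ? *)
| GuardCst (i v : nat).        (* x_i = v ? *)

Definition com_code (c : com) : nat :=
  match c with
  | AssignZero i => 5 * i
  | AssignVar i j => 5 * npair i j + 1
  | AssignSucc i j => 5 * npair i j + 2
  | GuardVar i j => 5 * npair i j + 3
  | GuardCst i v => 5 * npair i v + 4
  end.

Definition com_decode (z : nat) : com :=
  let w := z %/ 5 in
  let: (i, j) := nunpair w in
  match z %% 5 with
  | 0 => AssignZero w
  | 1 => AssignVar i j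
  | 2 => AssignSucc i j
  | 3 => GuardVar i j
  | _ => GuardCst i j
  end.

Lemma com_codeK : cancel com_code com_decode.
Proof.
case=> [i|i j|i j|i j|i v]; rewrite /com_decode /com_code mulnC.
- by rewrite modnMl mulnK //; case: (nunpair i).
- by rewrite modnMDl divnMDl // addn0 npairK.
- by rewrite modnMDl divnMDl // addn0 npairK.
- by rewrite modnMDl divnMDl // addn0 npairK.
- by rewrite modnMDl divnMDl // addn0 npairK.
Qed.

Lemma com_decodeK : cancel com_decode com_code.
Proof.
move=> z; rewrite [RHS](divn_eq z 5) mulnC /com_decode.
have := ltn_pmod z (isT : 0 < 5); have := nunpairK (z %/ 5).
case: (nunpair _) => i j /= eq_w.
by case: (z %% 5) => [|[|[|[|[|]]]]] // _; rewrite /= ?addn0 // eq_w.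
Qed.

#[warning="-redundant-canonical-projection"]
HB.instance Definition _ := Countable.copy com (can_type com_codeK).

(* The node set is {0, ..., top}; [edges] stands for the finite set of its
   members. *)
Record bacfg := Bacfg {
  top : nat;
  edges : seq ('I_top.+1 * com * 'I_top.+1);
  start : 'I_top.+1;
  stop : 'I_top.+1
}.

Definition node (G : bacfg) : finType := 'I_(top G).+1.

(* The largest index, counted from 1, of a variable of the command. *)
Definition com_nvars (c : com) : nat :=
  match c with
  | AssignZero i => i.+1
  | AssignVar i j => maxn i.+1 j.+1
  | AssignSucc i j => maxn i.+1 j.+1
  | GuardVar i j => maxn i.+1 j.+1
  | GuardCst i _ => i.+1
  end.

Definition nvars (G : bacfg) : nat :=
  \max_(e <- edges G) com_nvars e.1.2.

Definition dim (G : bacfg) (n : nat) : nat := maxn n (nvars G).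

Definition set_var k (i v : nat) (s : k.-tuple nat) : k.-tuple nat :=
  [tuple if (j : nat) == i then v else tnth s j | j < k].

(* The default of [nth] is never used on states of dimension [dim G n]. *)
Definition transfer k (c : com) (S : set (k.-tuple nat)) : set (k.-tuple nat) :=
  match c with
  | AssignZero i => [set set_var i 0 s | s in S]
  | AssignVar i j => [set set_var i (nth 0 s j) s | s in S]
  | AssignSucc i j => [set set_var i (nth 0 s j).+1 s | s in S]
  | GuardVar i j => [set s | S s /\ nth 0 s i = nth 0 s j]
  | GuardCst i v => [set s | S s /\ nth 0 s i = v]
  end.

Definition restr k' (k : nat) (S : set (k'.-tuple nat)) : set (k.-tuple nat) :=
  if k' < k then [set y | exists2 s, S s & take k' y = s :> seq nat]
  else [set y | exists2 s, S s & y = take k s :> seq nat].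
Arguments restr {k'} k S.

Definition solution (G : bacfg) n (x : n.-tuple nat)
    (X : node G -> set ((dim G n).-tuple nat)) : Prop :=
  restr (dim G n) [set x] `<=` X (start G) /\
  forall u c v, (u, c, v) \in edges G -> transfer c (X u) `<=` X v.
Arguments solution G {n} x X.

(* The least solution, as the intersection of all of them. *)
Definition collecting (G : bacfg) n (x : n.-tuple nat) (v : node G) :
    set ((dim G n).-tuple nat) :=
  \bigcap_(X in [set X | solution G x X]) X v.
Arguments collecting G {n} x v.

Lemma transferS k c (S T : set (k.-tuple nat)) :
  S `<=` T -> transfer c S `<=` transfer c T.
Proof.
move=> sST; case: c => [i|i j|i j|i j|i v] /=; try exact: image_subset.
  by move=> s [/sST].
by move=> s [/sST].
Qed.

Lemma collecting_least (G : bacfg) n (x : n.-tuple nat) :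
  solution G x (collecting G x) /\
  forall X, solution G x X -> forall v, collecting G x v `<=` X v.
Proof.
split; last by move=> X solX v s; apply.
split=> [s xs X [sol0 _]|u c v uv s us X solX]; first exact: sol0.
by apply: (solX.2 _ _ _ uv); apply: transferS us => s'; apply.
Qed.

(* A bijective numbering: the graph with largest node [top] is coded by
   <top, w>, where w is read with quotients and remainders by the number of
   nodes. *)
Definition edge_code d (e : 'I_d.+1 * com * 'I_d.+1) : nat :=
  let: (u, c, v) := e in (com_code c * d.+1 + v) * d.+1 + u.

Definition edge_decode d (z : nat) : 'I_d.+1 * com * 'I_d.+1 :=
  (inZp z, com_decode (z %/ d.+1 %/ d.+1), inZp (z %/ d.+1)).

Definition bacfg_code (G : bacfg) : nat :=
  let d := (top G).+1 in
  npair (top G)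
    ((CodeSeq.code (map (@edge_code _) (edges G)) * d + stop G) * d + start G).

Definition bacfg_of (a : nat) : bacfg :=
  let: (d, w) := nunpair a in
  @Bacfg d (map (@edge_decode d) (CodeSeq.decode (w %/ d.+1 %/ d.+1)))
    (inZp w) (inZp (w %/ d.+1)).

Lemma inZp_digit d q (u : 'I_d.+1) : inZp (q * d.+1 + u) = u.
Proof. by apply: val_inj; rewrite /= modnMDl modn_small. Qed.

Lemma div_digit d q (u : 'I_d.+1) : (q * d.+1 + u) %/ d.+1 = q.
Proof. by rewrite divnMDl // divn_small ?addn0. Qed.

Lemma edge_codeK d : cancel (@edge_code d) (@edge_decode d).
Proof.
by case=> [[u c] v]; rewrite /edge_decode /= !div_digit !inZp_digit com_codeK.
Qed.

Lemma edge_decodeK d : cancel (@edge_decode d) (@edge_code d).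
Proof. by move=> z; rewrite /= com_decodeK -!divn_eq. Qed.

Lemma bacfg_codeK : cancel bacfg_code bacfg_of.
Proof.
case=> d E s e; rewrite /bacfg_code /bacfg_of npairK /= !div_digit !inZp_digit.
by rewrite CodeSeq.codeK (mapK (@edge_codeK d)).
Qed.

Lemma bacfg_ofK : cancel bacfg_of bacfg_code.
Proof.
move=> a; rewrite -[RHS]nunpairK /bacfg_of /bacfg_code.
case: (nunpair a) => d w /=; congr npair.
by rewrite (mapK (@edge_decodeK d)) CodeSeq.decodeK -!divn_eq.
Qed.

Record abstract_semantics := AbstractSemantics {
  den : forall n : nat, nat -> pfun n;
  eqv : forall n : nat, pfun n -> pfun n -> Prop;
  eqv_equivalence : forall n, RelationClasses.Equivalence (@eqv n)
}.

(* [obind] makes the composite undefined where [phi m b] is. *)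
Definition strong_smn (pi : abstract_semantics) : Prop :=
  forall m n : nat, 1 <= m -> 1 <= n ->
  exists s : (m.+2).-tuple nat -> nat, computable s /\
  forall (a b : nat) (x : m.-tuple nat),
    eqv pi
      (fun y : n.-tuple nat =>
         obind (fun z => den pi a [tuple of z :: y]) (phi m b x))
      (@den pi n (s [tuple of [:: a, b & x]])).

(* The arity is n + 1, for n >= 0. *)
Definition branching (pi : abstract_semantics) : Prop :=
  forall n : nat,
  exists r : 4.-tuple nat -> nat, computable r /\
  forall a b c1 c2 x : nat, c1 <> c2 ->
    eqv pi
      (fun y : n.-tuple nat =>
         den pi (r [tuple a; b; c1; c2]) [tuple of x :: y])
      (if x == c1 then fun y : n.-tuple nat => den pi a [tuple of x :: y]
       else if x == c2 then fun y : n.-tuple nat => den pi b [tuple of x :: y]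
       else fun=> None).

Definition discharging (pi : abstract_semantics) : Prop :=
  forall n : nat, 1 <= n ->
  exists t : 1.-tuple nat -> nat, computable t /\
  forall a x : nat,
    eqv pi (@den pi n a)
      (fun y : n.-tuple nat => den pi (t [tuple a]) [tuple of x :: y]).

Definition state_den t (Q : set (set (t.-tuple nat))) n (a : nat) : pfun n :=
  fun x =>
    let G := bacfg_of a in
    let S := collecting G x (stop G) in
    if `[< S !=set0 >] then Some (if `[< Q (restr t S) >] then 1 else 0)
    else None.

Definition state_semantics t (Q : set (set (t.-tuple nat))) :
    abstract_semantics :=
  @AbstractSemantics (state_den Q) (fun n => @eq (pfun n))
    (fun n => RelationClasses.eq_equivalence).

(* Main.v *)
Require Import Defs.
From mathcomp Require Import all_boot.
From mathcomp Require Import zmodp zify.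
From mathcomp Require Import boolp classical_sets.

(** A state set computed by a BACFG is the set of states reachable by its
    nondeterministic runs, in which the variables beyond the inputs start with
    arbitrary values. Equality guards suffice to test [x <> y]: set a scratch
    variable to [x + 1], increment it an arbitrary number of times and require
    that it equals [y] (or the same with [x] and [y] exchanged). Hence a graph
    can simulate a URM on fresh variables, which gives strong smn; branching
    puts two guards in front of copies of the two graphs, and discharging shifts
    the inputs and resets the freed variable to an arbitrary value. The codes of
    these graphs are primitive recursive in the given codes, and primitive
    recursive functions are URM-computable. *)

Set Implicit Arguments.
Unset Strict Implicit.
Unset Printing Implicit Defensive.
Local Open Scope classical_set_scope.
Local Open Scope nat_scope.

(** The observed value is a whole set of final states, so a simulating graph must produce every
    final state of the original, seen on the first [t] variables, and no other. Wrong
    nondeterministic guesses are harmless: their runs stick at a guard and never reach the end node.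
    For the same reason a diverging URM leaves the end node without states, which is the undefined
    case. Conversely, a variable that is arbitrary in the original must stay arbitrary; the
    simulated registers and the scratch variable therefore start at an offset [A] beyond [t], the
    inputs and all variables of the copied graph, and states are compared below [A] only. The number
    of registers and of program addresses varies with the given code, so the edges are listed by
    loops bounded by the codes themselves: a code dominates every index and every length in the
    object that it codes, and no maximum has to be computed. *)

Local Notation "e $ i" := (nth 0 e i) (at level 3, i at level 2, format "e $ i").

(** * URM-computability of primitive recursive functions *)

Lemma upd_same r i v : upd r i v i = v.
Proof. by rewrite /upd eqxx. Qed.

Lemma upd_other r i v j : j <> i -> upd r i v j = r j.
Proof. by move=> /eqP/negbTE; rewrite /upd => ->. Qed.

Definition steps (P : program) (c c' : config) :=
  exists k, iter k (step P) c = c'.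

Lemma steps_trans P c1 c2 c3 : steps P c1 c2 -> steps P c2 c3 -> steps P c1 c3.
Proof. by case=> k <- [l <-]; exists (l + k); rewrite iterD. Qed.

Lemma steps1 P c : steps P c (step P c).
Proof. by exists 1. Qed.

(* [p off] is the code of the fragment when it is loaded at address [off];
   jumps of URMs are absolute. *)
Definition fragment_for (F : regs -> regs) :=
  exists n p, [/\ 0 < n, forall off, size (p off) = n &
    forall pre post r, steps (pre ++ p (size pre) ++ post)
      (size pre, r) (size pre + n, F r)].

Lemma onth_mid (T : Type) (pre post : seq T) i :
  onth (pre ++ i :: post) (size pre) = Some i.
Proof. by elim: pre. Qed.

Lemma onth_at (T : Type) (s pre post : seq T) i k :
  size pre = k -> s = pre ++ i :: post -> onth s k = Some i.
Proof. by move=> <- ->; apply: onth_mid. Qed.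

Lemma fragment_zero i : fragment_for (fun r => upd r i 0).
Proof.
exists 1, (fun=> [:: Zero i]); split=> // pre post r.
by exists 1; rewrite /= onth_mid addn1.
Qed.

Lemma fragment_succ i : fragment_for (fun r => upd r i (r i).+1).
Proof.
exists 1, (fun=> [:: Succ i]); split=> // pre post r.
by exists 1; rewrite /= onth_mid addn1.
Qed.

Lemma fragment_transfer i j : fragment_for (fun r => upd r j (r i)).
Proof.
exists 1, (fun=> [:: Transfer i j]); split=> // pre post r.
by exists 1; rewrite /= onth_mid addn1.
Qed.

Lemma fragment_seq F G :
  fragment_for F -> fragment_for G -> fragment_for (fun r => G (F r)).
Proof.
move=> [n [p [n_gt0 sp Fp]]] [m [q [m_gt0 sq Gq]]].
exists (n + m), (fun off => p off ++ q (off + n)); split=> [|off|pre post r].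
- by rewrite addn_gt0 n_gt0.
- by rewrite size_cat sp sq.
rewrite -catA addnA; apply: steps_trans (Fp pre (_ ++ post) r) _.
have := Gq (pre ++ p (size pre)) post (F r).
by rewrite size_cat sp -catA.
Qed.

Definition loop_body (F : regs -> regs) c (r : regs) := upd (F r) c (F r c).+1.

(** URM instructions cannot decrement, so the counter [c] climbs from 0 until it equals the bound in
    [b]; both registers must therefore survive the body. *)
Lemma fragment_loop F c b : b <> c ->
  (forall r, F r c = r c) -> (forall r, F r b = r b) -> fragment_for F ->
  fragment_for (fun r => iter (r b) (loop_body F c) (upd r c 0)).
Proof.
move=> neq_bc Fc Fb [n [p [n_gt0 sp Fp]]].
(* [off.+1] is the address of the test and [off + n.+4] the first one past the fragment. [Jump 0 0]
   compares a register with itself, so it always jumps. *)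
pose code off := [:: Zero c; Jump c b (off + n.+4)] ++ p (off + 2) ++
  [:: Succ c; Jump 0 0 off.+1].
exists n.+4, code; split=> [|off|pre post r]; first by [].
  by rewrite /code /= size_cat sp /=; lia.
set P := pre ++ _; set off := size pre.
have at0 : onth P off = Some (Zero c) by rewrite /P /code /= onth_mid.
have at1 : onth P off.+1 = Some (Jump c b (off + n.+4)).
  apply: (onth_at (pre := rcons pre (Zero c))); first by rewrite size_rcons.
  by rewrite cat_rcons.
pose pre2 := pre ++ [:: Zero c; Jump c b (off + n.+4)].
have spre2 : size pre2 = off + 2 by rewrite size_cat.
have defP : P = pre2 ++ p (off + 2) ++ [:: Succ c, Jump 0 0 off.+1 & post].
  by rewrite /P /code /pre2 -!catA /= -?catA.
have at2 : onth P (off + 2 + n) = Some (Succ c).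
  apply: (onth_at (pre := pre2 ++ p (off + 2))); last by rewrite defP catA.
  by rewrite size_cat spre2 sp.
have at3 : onth P (off + 2 + n).+1 = Some (Jump 0 0 off.+1).
  apply: (onth_at (pre := rcons (pre2 ++ p (off + 2)) (Succ c))).
    by rewrite size_rcons size_cat spre2 sp.
  by rewrite cat_rcons -catA; exact: defP.
have inv k : iter k (loop_body F c) (upd r c 0) c = k /\
             iter k (loop_body F c) (upd r c 0) b = r b.
  elim: k => [|k [IHc IHb]] /=; first by rewrite upd_same upd_other.
  by rewrite /loop_body upd_same upd_other // Fc Fb IHc IHb.
have round k : k <= r b -> steps P (off, r)
    (off.+1, iter k (loop_body F c) (upd r c 0)).
  elim: k => [_|k IHk lt_k].
    by have := steps1 P (off, r); rewrite /step at0.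
  apply: steps_trans (IHk (ltnW lt_k)) _; move: (inv k).
  set rk := iter k (loop_body F c) _ => -[rkc rkb].
  have := steps1 P (off.+1, rk); rewrite /step at1 rkc rkb ltn_eqF //.
  move=> /steps_trans; apply; rewrite -addn2.
  have := Fp pre2 [:: Succ c, Jump 0 0 off.+1 & post] rk.
  rewrite spre2 -defP => /steps_trans; apply.
  have := steps1 P (off + 2 + n, F rk); rewrite /step at2 => /steps_trans; apply.
  have := steps1 P ((off + 2 + n).+1, upd (F rk) c (F rk c).+1).
  by rewrite /step at3 eqxx.
apply: steps_trans (round _ (leqnn _)) _.
have := steps1 P (off.+1, iter (r b) (loop_body F c) (upd r c 0)).
by rewrite /step at1 (inv _).1 (inv _).2 eqxx.
Qed.

(* The fragment reads its arguments in the registers [ins], writes the value of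
   [f] in [o] and uses the registers from [B] on as scratch space. *)
Definition pr (f : seq nat -> nat) :=
  forall (ins : seq nat) (o B : nat), all (fun i => i < B) ins -> o < B ->
  exists2 F, fragment_for F &
    forall r, F r o = f (map r ins) /\
      forall j, j < B -> j <> o -> F r j = r j.

Lemma eq_pr f g : pr f -> f =1 g -> pr g.
Proof. by move=> pf /funext <-. Qed.

Lemma run_halted p n (x : n.-tuple nat) k k' :
  halted p (run p x k) -> k <= k' -> run p x k' = run p x k.
Proof.
move=> hk /subnK <-; rewrite {1}/run iterD -/(run p x k).
case: (run p x k) hk => pc r hk; elim: (k' - k) => //= j ->.
by move: hk; rewrite /halted /= -onthNE; case: onth.
Qed.

Lemma urm_fun_halted p n (x : n.-tuple nat) k :
  halted p (run p x k) -> urm_fun p x = Some ((run p x k).2 0).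
Proof.
rewrite /urm_fun => hk; case: pselect => [ex|[]]; last by exists k.
by case: ex_minnP => k0 h0 /(_ _ hk) /(run_halted h0) ->.
Qed.

Lemma urm_fun_Some p n (x : n.-tuple nat) z : urm_fun p x = Some z ->
  exists2 k, halted p (run p x k) & (run p x k).2 0 = z.
Proof.
rewrite /urm_fun; case: pselect => // ex [<-].
by case: ex_minnP => k hk _; exists k.
Qed.

(** Arguments and result sit where [phi] expects them. The scratch space starts at [n.+1], so that
    the output register 0 lies below it even for [n = 0]. Only nonempty programs have a code, which
    is why fragments are required to be nonempty. *)
Lemma pr_computable f n : pr f -> computable (fun x : n.-tuple nat => f x).
Proof.
move=> /(_ (iota 0 n) 0 n.+1) [||F [k [p [k_gt0 sp Fp]]] Ff] //.
  by apply/allP => i; rewrite mem_iota => /andP[_ /leqW].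
exists (program_code (p 0)) => x.
rewrite /phi program_codeK ?sp //.
have [K runK] := Fp [::] [::] (fun i => nth 0 x i).
rewrite cats0 /= in runK.
rewrite (@urm_fun_halted _ _ _ K) /run /init runK /halted /= ?sp //.
by rewrite (Ff _).1 -{2}[tval x](mkseq_nth 0) /mkseq size_tuple.
Qed.

Lemma pr_nth i : pr (fun e => nth 0 e i).
Proof.
move=> ins o B /allP insB oB; have [lt_i|le_i] := ltnP i (size ins).
  exists (fun r => upd r o (r (nth 0 ins i))); first exact: fragment_transfer.
  move=> r; rewrite upd_same (nth_map 0) //; split=> // j _ /eqP/negbTE.
  by rewrite /upd => ->.
exists (fun r => upd r o 0); first exact: fragment_zero.
move=> r; rewrite upd_same nth_default ?size_map //; split=> // j _.
exact: upd_other.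
Qed.

Lemma pr_const n : pr (fun=> n).
Proof.
move=> ins o B insB oB; elim: n => [|n [F fF Fn]].
  exists (fun r => upd r o 0); first exact: fragment_zero.
  by move=> r; rewrite upd_same; split=> // j _; apply: upd_other.
exists (fun r => upd (F r) o (F r o).+1).
  exact: fragment_seq fF (fragment_succ o).
move=> r; rewrite upd_same (Fn r).1; split=> // j jB jo.
by rewrite upd_other // (Fn r).2.
Qed.

Lemma pr_succ f : pr f -> pr (fun e => (f e).+1).
Proof.
move=> pf ins o B insB oB; have [F fF Ff] := pf ins o B insB oB.
exists (fun r => upd (F r) o (F r o).+1).
  exact: fragment_seq fF (fragment_succ o).
move=> r; rewrite upd_same (Ff r).1; split=> // j jB jo.
by rewrite upd_other // (Ff r).2.
Qed.

Lemma fragment_noop : fragment_for (fun r => r).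
Proof.
have := fragment_transfer 0 0; congr fragment_for; apply/funext => r.
by apply/funext => j; rewrite /upd; case: eqP => [->|].
Qed.

(** Results are stored in consecutive registers from [B] on; each further function gets a scratch
    bound larger by one, which protects what is already stored. *)
Lemma fragment_map gs ins B : (forall g, List.In g gs -> pr g) ->
  all (fun i => i < B) ins ->
  exists2 F, fragment_for F &
    forall r, (forall j, j < B -> F r j = r j) /\
      map (F r) (iota B (size gs)) = [seq g (map r ins) | g <- gs].
Proof.
elim: gs B => [|g gs IH] B /= pgs insB.
  by exists (fun r => r) => //; exact: fragment_noop.
have weak : all (fun i => i < B.+1) ins by apply: sub_all insB => i /leqW.
have [G fG Gg] := pgs g (or_introl erefl) ins B B.+1 weak (leqnn _).
have [F fF Fgs] := IH B.+1 (fun h hgs => pgs h (or_intror hgs)) weak.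
exists (fun r => F (G r)); first exact: fragment_seq.
move=> r; split=> [j jB|].
  by rewrite (Fgs _).1 ?(Gg _).2; lia.
rewrite (Fgs (G r)).1 // (Fgs (G r)).2 (Gg r).1; congr cons.
have -> // : map (G r) ins = map r ins.
apply/eq_in_map => i /(allP insB) iB; rewrite (Gg r).2 //; lia.
Qed.

Lemma pr_comp f gs : pr f -> (forall g, List.In g gs -> pr g) ->
  pr (fun e => f [seq g e | g <- gs]).
Proof.
move=> pf pgs ins o B insB oB.
have [G fG Ggs] := fragment_map pgs insB.
have [||F fF Ff] := pf (iota B (size gs)) o (B + size gs).
- by apply/allP => i; rewrite mem_iota => /andP[].
- by rewrite ltn_addr.
exists (fun r => F (G r)); first exact: fragment_seq.
move=> r; rewrite (Ff (G r)).1 (Ggs r).2; split=> // j jB jo.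
by rewrite (Ff _).2 ?(Ggs _).1 // ltn_addr.
Qed.

(** Primitive recursion: [B], [B.+1] and [B.+2] hold the counter, the accumulator and the bound. In
    every later use, [e$0] inside [H] is the index, [e$1] the accumulator, and the parameters begin
    at [e$2]. *)
Lemma pr_iteri N H G : pr N -> pr G -> pr H ->
  pr (fun e => iteri (N e) (fun i acc => H [:: i, acc & e]) (G e)).
Proof.
move=> pN pG pH ins o B insB oB.
have weak : all (fun i => i < B.+3) ins by apply: sub_all insB => i; lia.
have [FN fN FNE] := pN ins B.+2 B.+3 weak (leqnn _).
have [|FG fG FGE] := pG ins B.+1 B.+3 weak; first by lia.
have [||FH fH FHE] := pH [:: B, B.+1 & ins] B.+1 B.+3.
- by rewrite /= weak; lia.
- by lia.
have fL : fragment_for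
    (fun r => iter (r B.+2) (loop_body FH B) (upd r B 0)).
  by apply: fragment_loop fH => [|r|r]; rewrite ?(FHE r).2; lia.
exists (fun r => upd (iter (FG (FN r) B.+2) (loop_body FH B)
                        (upd (FG (FN r)) B 0)) o
     (iter (FG (FN r) B.+2) (loop_body FH B) (upd (FG (FN r)) B 0) B.+1)).
  apply: (fragment_seq _ (fragment_transfer B.+1 o)).
  apply: (fragment_seq _ fL).
  exact: fragment_seq.
move=> r; rewrite upd_same; set r1 := FG (FN r).
have r1B j : j < B -> r1 j = r j.
  by move=> jB; rewrite /r1 (FGE _).2 ?(FNE _).2; lia.
have map_ins s : (forall j, j < B -> s j = r j) -> map s ins = map r ins.
  by move=> sr; apply/eq_in_map => i /(allP insB); apply: sr.
have r1N : r1 B.+2 = N (map r ins).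
  by rewrite /r1 (FGE _).2 ?(FNE _).1; lia.
have r1G : r1 B.+1 = G (map r ins).
  rewrite /r1 (FGE _).1; congr G; apply: map_ins => j jB.
  by rewrite (FNE r).2; lia.
have inv k : let s := iter k (loop_body FH B) (upd r1 B 0) in
  [/\ s B = k, forall j, j < B -> s j = r j &
    s B.+1 = iteri k (fun i acc => H [:: i, acc & map r ins]) (G (map r ins))].
  elim: k => [|k [IHc IHr IHa]] /=.
    rewrite upd_same; split=> // [j jB|].
      by rewrite upd_other ?r1B; lia.
    by rewrite upd_other ?r1G; lia.
  move: IHc IHr IHa; set s := iter _ _ _ => IHc IHr IHa; rewrite /loop_body.
  split=> [|j jB|]; first by rewrite upd_same (FHE s).2 ?IHc; lia.
    by rewrite upd_other ?(FHE s).2 ?IHr; lia.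
  rewrite upd_other; last by lia.
  by rewrite (FHE s).1 /= IHc IHa (map_ins s).
rewrite r1N; have [_ IHr ->] := inv (N (map r ins)); split=> // j jB jo.
by rewrite upd_other // IHr.
Qed.

(** * Arithmetic and coded lists *)

Lemma pr_comp1 F f : pr (fun e => F e$0) -> pr f -> pr (fun e => F (f e)).
Proof. by move=> pF pf; apply: (pr_comp (gs := [:: f]) pF) => g /= [<-|]. Qed.

Lemma pr_comp2 F f g : pr (fun e => F e$0 e$1) ->
  pr f -> pr g -> pr (fun e => F (f e) (g e)).
Proof.
by move=> pF pf pg; apply: (pr_comp (gs := [:: f; g]) pF) => h /= [<-|[<-|]].
Qed.

Lemma pr_comp3 F f g h : pr (fun e => F e$0 e$1 e$2) ->
  pr f -> pr g -> pr h -> pr (fun e => F (f e) (g e) (h e)).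
Proof.
move=> pF pf pg ph.
by apply: (pr_comp (gs := [:: f; g; h]) pF) => k /= [<-|[<-|[<-|]]].
Qed.

Lemma pr_addn f g : pr f -> pr g -> pr (fun e => f e + g e).
Proof.
apply: (pr_comp2 (F := addn)).
apply: (eq_pr (pr_iteri (H := fun e => (e$1).+1) (pr_nth 0) (pr_nth 1)
  (pr_succ (pr_nth 1)))) => e /=.
by elim: (e$0) => //= n ->.
Qed.

Lemma pr_predn f : pr f -> pr (fun e => (f e).-1).
Proof.
apply: (pr_comp1 (F := predn)).
(* The predecessor is the last index of the loop. *)
apply: (eq_pr (pr_iteri (H := fun e => e$0) (pr_nth 0) (pr_const 0)
  (pr_nth 0))) => e /=.
by case: (e$0).
Qed.

Lemma pr_subn f g : pr f -> pr g -> pr (fun e => f e - g e).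
Proof.
apply: (pr_comp2 (F := subn)).
apply: (eq_pr (pr_iteri (H := fun e => (e$1).-1) (pr_nth 1) (pr_nth 0)
  (pr_predn (pr_nth 1)))) => e /=.
by elim: (e$1) => [|n /= ->] /=; rewrite ?subn0 ?subnS.
Qed.

Lemma pr_muln f g : pr f -> pr g -> pr (fun e => f e * g e).
Proof.
apply: (pr_comp2 (F := muln)).
apply: (eq_pr (pr_iteri (H := fun e => e$1 + e$3) (pr_nth 0) (pr_const 0)
  (pr_addn (pr_nth 1) (pr_nth 3)))) => e /=.
by elim: (e$0) => //= n ->; rewrite mulSn addnC.
Qed.

Lemma pr_expn f g : pr f -> pr g -> pr (fun e => f e ^ g e).
Proof.
apply: (pr_comp2 (F := expn)).
apply: (eq_pr (pr_iteri (H := fun e => e$1 * e$2) (pr_nth 1) (pr_const 1)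
  (pr_muln (pr_nth 1) (pr_nth 2)))) => e /=.
by elim: (e$1) => //= n ->; rewrite expnSr.
Qed.

(** A loop of [b] rounds, hence at most one, whose body ignores the accumulator and returns [f]; the
    start value is [g]. *)
Lemma pr_if (b : seq nat -> bool) f g : pr (fun e => b e) -> pr f -> pr g ->
  pr (fun e => if b e then f e else g e).
Proof.
move=> pb pf pg.
suff pc : pr (fun e => iteri e$0 (fun _ _ => e$1) e$2).
  apply: (eq_pr (pr_comp3 (F := fun k x y => iteri k (fun _ _ => x) y)
    pc pb pf pg)) => e /=.
  by case: (b e).
exact: (pr_iteri (H := fun e => e$3) (pr_nth 0) (pr_nth 2) (pr_nth 3)).
Qed.

Lemma pr_eq0 f : pr f -> pr (fun e => f e == 0).
Proof.
move=> pf; apply: (eq_pr (pr_subn (pr_const 1) pf)) => e.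
by case: (f e) => [|n] //; rewrite subSS sub0n.
Qed.

Lemma pr_leq f g : pr f -> pr g -> pr (fun e => f e <= g e).
Proof. by move=> pf pg; apply: pr_eq0 (pr_subn pf pg). Qed.

Lemma pr_eq f g : pr f -> pr g -> pr (fun e => f e == g e).
Proof.
move=> pf pg; apply: (eq_pr (pr_muln (pr_leq pf pg) (pr_leq pg pf))) => e.
by rewrite mulnb -eqn_leq.
Qed.

(** Quotients and 2-adic valuations are computed by counting the indices below them, since [i < q]
    can be tested without knowing [q]. *)
Lemma iteri_count q k : iteri k (fun i acc => acc + (i < q)) 0 = minn k q.
Proof. by elim: k => [|k IHk] /=; rewrite ?IHk; lia. Qed.

Lemma pr_divn f g : pr f -> pr g -> pr (fun e => f e %/ g e).
Proof.
apply: (pr_comp2 (F := divn)).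
(* [i < m %/ d] amounts to [i.+1 * d <= m] for positive [d]; the factor [0 < d] gives division by
   zero its value 0. *)
apply: (eq_pr (pr_iteri
  (H := fun e => e$1 + (0 < e$3) * ((e$0).+1 * e$3 <= e$2))
  (pr_nth 0) (pr_const 0) _)) => [|e /=].
  apply: pr_addn (pr_nth 1) (pr_muln (pr_leq (pr_const 1) (pr_nth 3)) _).
  exact: pr_leq (pr_muln (pr_succ (pr_nth 0)) (pr_nth 3)) (pr_nth 2).
move: (e$0) (e$1) => m d.
rewrite (eq_iteri (f' := fun i acc => acc + (i < m %/ d))) => [|i acc].
  by rewrite iteri_count; apply/minn_idPr; rewrite leq_div.
case: d => [|d]; first by rewrite divn0.
by rewrite leq_divRL // mul1n.
Qed.

Lemma pr_modn f g : pr f -> pr g -> pr (fun e => f e %% g e).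
Proof.
move=> pf pg; apply: (eq_pr (pr_subn pf (pr_muln (pr_divn pf pg) pg))) => e.
by rewrite {1}(divn_eq (f e) (g e)) addKn.
Qed.

Lemma pr_half f : pr f -> pr (fun e => (f e)./2).
Proof.
by move=> pf; apply: (eq_pr (pr_divn pf (pr_const 2))) => e; rewrite divn2.
Qed.

Lemma pr_double f : pr f -> pr (fun e => (f e).*2).
Proof.
by move=> pf; apply: (eq_pr (pr_addn pf pf)) => e; rewrite addnn.
Qed.

Lemma pr_logn2 f : pr f -> pr (fun e => logn 2 (f e)).
Proof.
apply: (pr_comp1 (F := (logn 2))).
(* [i < logn 2 m] means that [2 ^ i.+1] divides [m]; the factor [0 < m] excludes 0, which every
   power divides although its [logn] is 0. *)
apply: (eq_pr (pr_iteri
  (H := fun e => e$1 + (0 < e$2) * (e$2 %% 2 ^ (e$0).+1 == 0))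
  (pr_nth 0) (pr_const 0) _)) => [|e /=].
  apply: pr_addn (pr_nth 1) (pr_muln (pr_leq (pr_const 1) (pr_nth 2)) _).
  apply: pr_eq0; apply: pr_modn (pr_nth 2) _.
  exact: pr_expn (pr_const 2) (pr_succ (pr_nth 0)).
move: (e$0) => m.
rewrite (eq_iteri (f' := fun i acc => acc + (i < logn 2 m))) => [|i acc].
  rewrite iteri_count; apply/minn_idPr; case: m => // m.
  by apply: ltnW; apply: ltn_logl.
case: m => [|m] //; rewrite mul1n; congr (_ + _).
by rewrite -[_ == 0]/(2 ^ i.+1 %| m.+1) pfactor_dvdn.
Qed.

Lemma pr_npair f g : pr f -> pr g -> pr (fun e => npair (f e) (g e)).
Proof.
move=> pf pg; apply: pr_predn; apply: pr_muln (pr_expn (pr_const 2) pf) _.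
exact: pr_succ (pr_double pg).
Qed.

Lemma pr_nunpair1 f : pr f -> pr (fun e => (nunpair (f e)).1).
Proof. by move=> pf; apply: pr_logn2 (pr_succ pf). Qed.

Lemma pr_nunpair2 f : pr f -> pr (fun e => (nunpair (f e)).2).
Proof.
move=> pf; apply/pr_half/(pr_divn (pr_succ pf)).
exact: pr_expn (pr_const 2) (pr_logn2 (pr_succ pf)).
Qed.

(** * Lists coded as numbers *)

Definition prl (f : seq nat -> seq nat) := pr (fun e => CodeSeq.code (f e)).

Lemma prl_nil : prl (fun=> [::]).
Proof. exact: pr_const. Qed.

Lemma code_cons n s : CodeSeq.code (n :: s) = 2 ^ n * (CodeSeq.code s).*2.+1.
Proof. by []. Qed.

Lemma code_eq0 s : (CodeSeq.code s == 0) = (s == [::]).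
Proof. by case: s => // n s; rewrite code_cons muln_eq0 expn_eq0. Qed.

Lemma prl_cons f g : pr f -> prl g -> prl (fun e => f e :: g e).
Proof.
move=> pf pg; apply: pr_muln (pr_expn (pr_const 2) pf) _.
exact: pr_succ (pr_double pg).
Qed.

Lemma prl_decode f : pr f -> prl (fun e => CodeSeq.decode (f e)).
Proof. by move=> pf; apply: (eq_pr pf) => e; rewrite CodeSeq.decodeK. Qed.

Lemma prl_if (b : seq nat -> bool) f g : pr (fun e => b e) -> prl f -> prl g ->
  prl (fun e => if b e then f e else g e).
Proof.
move=> pb pf pg; apply: (eq_pr (pr_if pb pf pg)) => e /=.
by case: (b e).
Qed.

(** A nonempty list has code [2 ^ n * (2 * tail + 1)]: its valuation is the head, and half of its
    odd part codes the tail. The code 0 of the empty list is a fixed point. *)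
Definition code_tail l := (l %/ 2 ^ logn 2 l)./2.

Lemma logn2_code n s : logn 2 (CodeSeq.code (n :: s)) = n.
Proof.
have := congr1 fst (npairK n (CodeSeq.code s)).
by rewrite /nunpair /npair prednK // muln_gt0 expn_gt0.
Qed.

Lemma code_tailE s : code_tail (CodeSeq.code s) = CodeSeq.code (behead s).
Proof.
case: s => // n s; rewrite /code_tail logn2_code code_cons.
by rewrite mulKn ?expn_gt0 //= uphalf_double.
Qed.

Lemma iteri_tail k s :
  iteri k (fun _ l => code_tail l) (CodeSeq.code s) = CodeSeq.code (drop k s).
Proof.
elim: k => [|k /= ->]; first by rewrite drop0.
by rewrite code_tailE -[behead _]drop1 drop_drop add1n.
Qed.

Lemma prl_drop f g : pr f -> prl g -> prl (fun e => drop (f e) (g e)).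
Proof.
move=> pf pg; rewrite /prl.
apply: (eq_pr (pr_comp2 (F := fun k l => iteri k (fun _ l => code_tail l) l)
  _ pf pg)) => [|e]; last exact: iteri_tail.
apply: (pr_iteri (H := fun e => code_tail e$1) (pr_nth 0) (pr_nth 1)).
apply/pr_half/(pr_divn (pr_nth 1))/(pr_expn (pr_const 2)).
exact: pr_logn2 (pr_nth 1).
Qed.

(** The entry is the head of the dropped list, that is, the valuation of its code. Past the end this
    is [logn 2 0 = 0], which agrees with the default of [nth]. *)
Lemma pr_nth_list f g : pr f -> prl g -> pr (fun e => (g e)$(f e)).
Proof.
move=> pf pg; apply: (eq_pr (pr_logn2 (prl_drop pf pg))) => e.
rewrite -[f e in RHS]addn0 -nth_drop.
by case: (drop _ _) => // n s; rewrite logn2_code.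
Qed.

Lemma pr_size_leq f g : pr f -> prl g -> pr (fun e => size (g e) <= f e).
Proof.
move=> pf pg; apply: (eq_pr (pr_eq0 (prl_drop pf pg))) => e.
by rewrite code_eq0 -size_eq0 size_drop subn_eq0.
Qed.

(** Allows the code of a list to bound a loop over its entries; the rounds past the end are made to
    do nothing. *)
Lemma size_le_code s : size s <= CodeSeq.code s.
Proof.
elim: s => // n s IHs; rewrite [size _]/= code_cons.
have : 0 < 2 ^ n by rewrite expn_gt0.
nia.
Qed.

Lemma catrev_iteri s1 s2 :
  iteri (CodeSeq.code s1) (fun i l =>
    if CodeSeq.code (drop i s1) == 0 then l
    else 2 ^ logn 2 (CodeSeq.code (drop i s1)) * l.*2.+1) (CodeSeq.code s2)
  = CodeSeq.code (catrev s1 s2).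
Proof.
rewrite -[s1 in RHS](take_oversize (size_le_code s1)).
elim: (CodeSeq.code s1) => [|k /= ->]; first by rewrite take0.
rewrite code_eq0; have [le_k|lt_k] := leqP (size s1) k.
  by rewrite drop_oversize // !take_oversize // ltnW.
rewrite (drop_nth 0 lt_k) logn2_code (take_nth 0 lt_k) /=.
by rewrite -code_cons -cats1 catrev_catl.
Qed.

Definition code_catrev l1 l2 :=
  CodeSeq.code (catrev (CodeSeq.decode l1) (CodeSeq.decode l2)).

Lemma pr_code_catrev f g :
  pr f -> pr g -> pr (fun e => code_catrev (f e) (g e)).
Proof.
apply: (pr_comp2 (F := code_catrev)).
pose D e := CodeSeq.code (drop e$0 (CodeSeq.decode e$2)).
have pD : pr D by apply: prl_drop (pr_nth 0) (prl_decode (pr_nth 2)).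
apply: (eq_pr (pr_iteri
  (H := fun e => if D e == 0 then e$1 else 2 ^ logn 2 (D e) * (e$1).*2.+1)
  (pr_nth 0) (pr_nth 1) _)) => [|e]; last first.
  have := catrev_iteri (CodeSeq.decode e$0) (CodeSeq.decode e$1).
  by rewrite !CodeSeq.decodeK.
apply: pr_if (pr_eq0 pD) (pr_nth 1) _.
apply: pr_muln (pr_expn (pr_const 2) (pr_logn2 pD)) _.
exact: pr_succ (pr_double (pr_nth 1)).
Qed.

Definition collect N (F : nat -> seq nat) acc0 :=
  iteri N (fun i acc => catrev (F i) acc) acc0.

Lemma mem_collect N F acc0 z :
  z \in collect N F acc0 <->
  z \in acc0 \/ exists i, i < N /\ z \in F i.
Proof.
elim: N => [|N IHN]; first by split=> [|[|[i []]]] //; left.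
rewrite [collect _ _ _]/=.
have -> : (z \in catrev (F N) (collect N F acc0)) =
          (z \in F N) || (z \in collect N F acc0).
  by rewrite catrevE mem_cat mem_rev.
split=> [/orP[zF|/IHN[]]|[z0|[i [lt_iN zF]]]].
- by right; exists N.
- by left.
- by move=> [i [lt_iN zF]]; right; exists i; rewrite ltnW .
- by apply/orP; right; apply/IHN; left.
- case: (eqVneq i N) => [<-|neq]; apply/orP; first by left.
  by right; apply/IHN; right; exists i; split=> //; lia.
Qed.

(** [pr_iteri] passes the accumulator in second place although the lists do not depend on it; the
    last hypothesis says so, and the 0 is a dummy for that place. *)
Lemma prl_collect N F G : pr N -> prl F -> prl G ->
  (forall i l l' e, F [:: i, l & e] = F [:: i, l' & e]) ->
  prl (fun e => collect (N e) (fun i => F [:: i, 0 & e]) (G e)).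
Proof.
move=> pN pF pG Fl; apply: (eq_pr (pr_iteri
  (H := fun e => code_catrev (CodeSeq.code (F e)) e$1) pN pG _)) => [|e /=]; last first.
  rewrite /collect; elim: (N e) => //= n ->.
  by rewrite /code_catrev !CodeSeq.codeK (Fl _ _ 0).
exact: pr_code_catrev pF (pr_nth 1).
Qed.

(** * Runs of a BACFG *)

Definition cexec (c : com) (s : regs) : option regs :=
  match c with
  | AssignZero i => Some (upd s i 0)
  | AssignVar i j => Some (upd s i (s j))
  | AssignSucc i j => Some (upd s i (s j).+1)
  | GuardVar i j => if s i == s j then Some s else None
  | GuardCst i v => if s i == v then Some s else None
  end.

(** States are total functions, so that graphs of different dimensions share one state space. The
    set [I] is arbitrary, so that the states reached in one piece of a graph can serve as initial
    states of the next. *)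
Inductive reach (E : nat -> com -> nat -> Prop) (u0 : nat) (I : regs -> Prop) :
    nat -> regs -> Prop :=
| reach_start s : I s -> reach E u0 I u0 s
| reach_edge u c v s s' :
    reach E u0 I u s -> E u c v -> cexec c s = Some s' -> reach E u0 I v s'.

Definition agree k (s s' : regs) := forall i, i < k -> s i = s' i.

Definition starts_with (x : seq nat) (s : regs) :=
  agree (size x) s (fun i => nth 0 x i).

Lemma cexec_agree k c s s' r : com_nvars c <= k -> agree k s r ->
  cexec c s = Some s' -> exists r',
  [/\ cexec c r = Some r', agree k s' r' & forall i, k <= i -> r' i = r i].
Proof.
have agree_upd i v : i < k -> agree k s r -> agree k (upd s i v) (upd r i v).
  by move=> lt_i sr j lt_j; rewrite /upd sr.
have upd_ge i v : i < k -> forall j, k <= j -> upd r i v j = r j.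
  by move=> lt_i j le_j; rewrite upd_other //; lia.
case: c => [i|i j|i j|i j|i v] /=; rewrite ?geq_max => lt_k sr.
- case=> <-; exists (upd r i 0); split=> //; by [apply: agree_upd|apply: upd_ge].
- move/andP: lt_k => [lt_i lt_j] [<-]; rewrite (sr j) //.
  exists (upd r i (r j)); split=> //; by [apply: agree_upd|apply: upd_ge].
- move/andP: lt_k => [lt_i lt_j] [<-]; rewrite (sr j) //.
  exists (upd r i (r j).+1); split=> //; by [apply: agree_upd|apply: upd_ge].
- move/andP: lt_k => [lt_i lt_j]; rewrite !sr //.
  by case: ifP => // _ [<-]; exists r.
- by rewrite !sr //; case: ifP => // _ [<-]; exists r.
Qed.

Lemma reach_agree k (E : nat -> com -> nat -> Prop) u0 (I J : regs -> Prop) v s :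
  (forall u c v, E u c v -> com_nvars c <= k) ->
  (forall s, I s -> exists2 r, J r & agree k s r) ->
  reach E u0 I v s -> exists2 r, reach E u0 J v r & agree k s r.
Proof.
move=> Ek IJ; elim=> [{}s /IJ[r Jr sr]|u c {}v {}s s' _ [r ur sr] e cs].
  by exists r => //; apply: reach_start.
have [r' [cr s'r' _]] := cexec_agree (Ek _ _ _ e) sr cs.
by exists r' => //; apply: reach_edge ur e cr.
Qed.

(** Variables from [k] on are neither read nor written, so a change of their final values can be
    carried back to the start, where [I] leaves them free. *)
Lemma reach_closed k (E : nat -> com -> nat -> Prop) u0 (I : regs -> Prop) v s r :
  (forall u c v, E u c v -> com_nvars c <= k) ->
  (forall s r, I s -> agree k s r -> I r) ->
  reach E u0 I v s -> agree k s r -> reach E u0 I v r.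
Proof.
move=> Ek Ik us; elim: us r => [{}s Is|u c {}v {}s s' _ IH e cs] r sr.
  by apply: reach_start; apply: Ik sr.
(* The state before the last command: the variables in use as in [s], the others already with their
   target values from [r]. *)
pose r0 i := if i < k then s i else r i.
have sr0 : agree k s r0 by move=> i lt_i; rewrite /r0 lt_i.
have [r' [cr s'r' r'r]] := cexec_agree (Ek _ _ _ e) sr0 cs.
apply: reach_edge (IH _ sr0) e _; rewrite cr; congr Some; apply/funext => i.
have [lt_i|le_i] := ltnP i k; first by rewrite -s'r' // sr.
by rewrite r'r // /r0 ltnNge le_i.
Qed.

Lemma eq_reach E E' u0 (I I' : regs -> Prop) v s :
  (forall u c v, E u c v -> E' u c v) -> (forall s, I s -> I' s) ->
  reach E u0 I v s -> reach E' u0 I' v s.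
Proof.
move=> EE' II'; elim=> [{}s /II'|u c {}v {}s s' _ IH /EE' e cs].
  exact: reach_start.
exact: reach_edge IH e cs.
Qed.

Definition graph_edge (G : bacfg) u c v := exists u' v' : node G,
  [/\ (u', c, v') \in edges G, val u' = u & val v' = v].

Definition state_tuple (k : nat) (s : regs) : k.-tuple nat :=
  [tuple s i | i < k].

Lemma nth_state_tuple k s i : i < k -> nth 0 (state_tuple k s) i = s i.
Proof.
by move=> lt_i; rewrite -[i]/(val (Ordinal lt_i)) -tnth_nth tnth_mktuple.
Qed.

Lemma state_tuple_agree k s (y : k.-tuple nat) :
  state_tuple k s = y <-> agree k s (fun i => nth 0 y i).
Proof.
split=> [<- i lt_i|sy]; first by rewrite nth_state_tuple.
by apply: eq_from_tnth => i; rewrite tnth_mktuple sy // -tnth_nth.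
Qed.

Lemma state_tuple_nth k (y : k.-tuple nat) : state_tuple k (fun i => nth 0 y i) = y.
Proof. exact/state_tuple_agree. Qed.

Lemma take_state_tuple n k s :
  n <= k -> take n (state_tuple k s) = state_tuple n s :> seq nat.
Proof.
have valE j : state_tuple j s = mkseq s j :> seq nat.
  by rewrite /= /mkseq -val_enum_ord -map_comp.
by move=> le_nk; rewrite !valE /mkseq -map_take take_iota (minn_idPl le_nk).
Qed.

Lemma state_tuple_upd k s i v : state_tuple k (upd s i v) = set_var i v (state_tuple k s).
Proof.
by apply: eq_from_tnth => j; rewrite !tnth_mktuple.
Qed.

Lemma transfer_cexec k c s s' (S : set (k.-tuple nat)) : com_nvars c <= k ->
  cexec c s = Some s' -> S (state_tuple k s) -> transfer c S (state_tuple k s').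
Proof.
case: c => [i|i j|i j|i j|i v] /=; rewrite ?geq_max => lt_k.
- by case=> <- Ss; exists (state_tuple k s); rewrite ?state_tuple_upd.
- move/andP: lt_k => [lt_i lt_j] [<-] Ss; exists (state_tuple k s) => //.
  by rewrite state_tuple_upd nth_state_tuple.
- move/andP: lt_k => [lt_i lt_j] [<-] Ss; exists (state_tuple k s) => //.
  by rewrite state_tuple_upd nth_state_tuple.
- move/andP: lt_k => [lt_i lt_j]; case: eqP => // eq_ij [<-].
  by rewrite !nth_state_tuple.
- by case: eqP => // eq_i [<-]; rewrite nth_state_tuple.
Qed.

(** The witness works for every total extension of [z], because the run that leads to [z] ends in an
    extension that cannot be chosen. *)
Lemma cexec_transfer k c (S : set (k.-tuple nat)) y : com_nvars c <= k ->
  transfer c S y -> exists2 z, S z & forall s, state_tuple k s = z ->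
    exists2 s', cexec c s = Some s' & state_tuple k s' = y.
Proof.
case: c => [i|i j|i j|i j|i v] /=; rewrite ?geq_max => lt_k.
- move=> [z Sz <-]; exists z => // s <-.
  by exists (upd s i 0); rewrite ?state_tuple_upd.
- move/andP: lt_k => [lt_i lt_j] [z Sz <-]; exists z => // s <-.
  by exists (upd s i (s j)); rewrite ?state_tuple_upd ?nth_state_tuple.
- move/andP: lt_k => [lt_i lt_j] [z Sz <-]; exists z => // s <-.
  by exists (upd s i (s j).+1); rewrite ?state_tuple_upd ?nth_state_tuple.
- move/andP: lt_k => [lt_i lt_j] [Sz eq_ij]; exists y => // s eq_s.
  exists s => //; move: eq_ij; rewrite -eq_s !nth_state_tuple // => ->.
  by rewrite eqxx.
- move=> [Sz eq_i]; exists y => // s eq_s.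
  by exists s => //; move: eq_i; rewrite -eq_s nth_state_tuple // => ->; rewrite eqxx.
Qed.

Lemma graph_edge_nvars G u c v : graph_edge G u c v -> com_nvars c <= nvars G.
Proof.
move=> [u' [v' [e _ _]]]; rewrite /nvars.
exact: (@leq_bigmax_seq _ _ xpredT (fun e => com_nvars e.1.2) _ e).
Qed.

(** The truncated reachable states form a solution, which bounds the least one from above; induction
    on runs puts every reachable state into each solution. Since [n <= dim G n], restricting the
    input never discards a coordinate. *)
Lemma collectingP (G : bacfg) n (x : n.-tuple nat) (v : node G) y :
  collecting G x v y <-> exists2 s,
    reach (graph_edge G) (val (start G)) (starts_with x) (val v) s &
    state_tuple (dim G n) s = y.
Proof.
set k := dim G n; have le_nk : n <= k by apply: leq_maxl.
have nvars_k u c w : graph_edge G u c w -> com_nvars c <= k.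
  by move=> /graph_edge_nvars le_c; apply: leq_trans le_c (leq_maxr _ _).
split=> [|[s]].
- pose X (v : node G) := [set y : k.-tuple nat | exists2 s,
    reach (graph_edge G) (val (start G)) (starts_with x) (val v) s &
    state_tuple k s = y].
  apply: ((collecting_least G x).2 X _ v y).
  split=> [z|u c w uw z].
    rewrite /restr => zx; exists (fun i => nth 0 z i); last exact: state_tuple_nth.
    apply: reach_start => i; rewrite size_tuple => lt_i.
    move: zx; case: ifP => _ /= [_ -> eq_x]; last first.
      by rewrite eq_x nth_take //; apply: leq_trans le_nk.
    by rewrite -eq_x nth_take.
  have e : graph_edge G u c w by exists u, w.
  move=> /(cexec_transfer (nvars_k _ _ _ e)) [_ [s us <-]] /(_ s erefl)[s' cs <-].
  by exists s' => //; apply: reach_edge us e cs.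
- move=> vs <-; have [sol0 sol1] := (collecting_least G x).1.
  suff gen v0 : reach (graph_edge G) (val (start G)) (starts_with x) v0 s ->
      forall v, val v = v0 -> collecting G x v (state_tuple k s) by apply: (gen _ vs).
  elim=> {v vs v0 s}.
    move=> s xs v /val_inj ->; apply: sol0; rewrite /restr -/k.
    have sx : state_tuple n s = x by apply/state_tuple_agree; rewrite -{1}(size_tuple x).
    case: ltnP => [lt_nk|le_kn]; exists x => //; rewrite -sx take_state_tuple //.
  move=> u c w s s' _ IH e cs v eq_v; have lt_c := nvars_k _ _ _ e.
  case: e => u' [v' [e eq_u eq_v']].
  have eq_vv : v = v' by apply: val_inj; rewrite eq_v eq_v'.
  rewrite eq_vv; apply: (sol1 _ _ _ e); apply: transfer_cexec cs _ => //.
  exact: IH.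
Qed.

(** * Reading a graph off its code, with plain numbers as nodes *)

Definition gsize a := (nunpair a).1.+1.
Definition gstart a := (nunpair a).2 %% gsize a.
Definition gstop a := (nunpair a).2 %/ gsize a %% gsize a.
Definition glist a := CodeSeq.decode ((nunpair a).2 %/ gsize a %/ gsize a).

Definition gedge a u c v := exists2 z, z \in glist a &
  [/\ u = z %% gsize a, c = com_decode (z %/ gsize a %/ gsize a) &
      v = z %/ gsize a %% gsize a].

Definition outcome a (x : seq nat) :=
  reach (gedge a) (gstart a) (starts_with x) (gstop a).

Lemma graph_edgeE a u c v : graph_edge (bacfg_of a) u c v <-> gedge a u c v.
Proof.
rewrite /graph_edge /gedge /node /glist /gsize /bacfg_of.
case: (nunpair a) => d w /=; set L := CodeSeq.decode _.
split=> [[u' [v' [/mapP[z zL]]]]|[z zL [-> -> ->]]].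
  by rewrite /edge_decode => -[-> -> ->] <- <-; exists z => //; split.
exists (inZp z), (inZp (z %/ d.+1)); split=> //.
by apply/mapP; exists z.
Qed.

Lemma graph_start a : val (start (bacfg_of a)) = gstart a.
Proof. by rewrite /gstart /gsize /bacfg_of; case: (nunpair a). Qed.

Lemma graph_stop a : val (stop (bacfg_of a)) = gstop a.
Proof. by rewrite /gstop /gsize /bacfg_of; case: (nunpair a). Qed.

Lemma collecting_stop a n (x : n.-tuple nat) y :
  collecting (bacfg_of a) x (stop (bacfg_of a)) y <-> exists2 s,
    outcome a x s & state_tuple (dim (bacfg_of a) n) s = y.
Proof.
rewrite collectingP; have sE u c v := propext (graph_edgeE a u c v).
have -> : graph_edge (bacfg_of a) = gedge a.
  by apply/funext => u; apply/funext => c; apply/funext => v.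
by rewrite graph_start graph_stop.
Qed.

Lemma outcome_closed a n (x : n.-tuple nat) s r :
  outcome a x s -> agree (dim (bacfg_of a) n) s r -> outcome a x r.
Proof.
apply: reach_closed => [u c v /graph_edgeE/graph_edge_nvars le_c|{}s {}r xs sr i].
  exact: leq_trans le_c (leq_maxr _ _).
rewrite size_tuple => lt_i; rewrite -sr ?xs ?size_tuple //.
by apply: leq_trans lt_i (leq_maxl _ _).
Qed.

(** Total states make the cases of the restriction uniform: truncation is immediate, and the
    cylinder for [t] above the dimension comes from [outcome_closed]. *)
Lemma restr_collecting t a n (x : n.-tuple nat) :
  restr t (collecting (bacfg_of a) x (stop (bacfg_of a))) =
  [set y | exists2 s, outcome a x s & state_tuple t s = y].
Proof.
set k := dim (bacfg_of a) n; apply/seteqP; rewrite /restr -/k.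
have [lt_kt|le_tk] := ltnP; split=> y.
- move=> [_ /collecting_stop[s os <-]] eq_y.
  exists (fun i => nth 0 y i); last exact: state_tuple_nth.
  apply: outcome_closed os _ => i lt_i.
  by rewrite -(nth_state_tuple s lt_i) -eq_y nth_take.
- move=> [s os <-]; exists (state_tuple k s); first by apply/collecting_stop; exists s.
  exact: take_state_tuple (ltnW lt_kt).
- move=> [_ /collecting_stop[s os <-]] eq_y; exists s => //.
  by apply: val_inj; rewrite /= -[RHS]/(tval y) eq_y take_state_tuple.
- move=> [s os <-]; exists (state_tuple k s); first by apply/collecting_stop; exists s.
  by rewrite take_state_tuple.
Qed.

Lemma collecting_nonempty a n (x : n.-tuple nat) :
  collecting (bacfg_of a) x (stop (bacfg_of a)) !=set0 <-> exists s, outcome a x s.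
Proof.
split=> [[y /collecting_stop[s os _]]|[s os]]; first by exists s.
by exists (state_tuple _ s); apply/collecting_stop; exists s.
Qed.

Lemma state_den_None t (Q : set (set (t.-tuple nat))) a n (x : n.-tuple nat) :
  (forall s, ~ outcome a x s) -> state_den Q a x = None.
Proof.
move=> no; rewrite /state_den; case: asboolP => // /collecting_nonempty[s].
by move/no.
Qed.

(** Both non-emptiness and membership in [Q] are determined by the outcomes cut to [t] variables, so
    the codes, arities and inputs may all differ. *)
Lemma eq_state_den t (Q : set (set (t.-tuple nat)))
    a n (x : n.-tuple nat) b m (y : m.-tuple nat) :
  (forall s, outcome a x s -> exists2 r, outcome b y r & agree t s r) ->
  (forall s, outcome b y s -> exists2 r, outcome a x r & agree t s r) ->
  state_den Q a x = state_den Q b y.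
Proof.
move=> ab ba; rewrite /state_den !restr_collecting.
have -> : (collecting (bacfg_of a) x (stop (bacfg_of a)) !=set0) =
          (collecting (bacfg_of b) y (stop (bacfg_of b)) !=set0).
  apply/propext; rewrite !collecting_nonempty.
  by split=> [[s /ab[r]]|[s /ba[r]]]; exists r.
suff -> : [set z | exists2 s, outcome a x s & state_tuple t s = z] =
          [set z | exists2 s, outcome b y s & state_tuple t s = z] by [].
by apply/seteqP; split=> z /= [s /[dup] os + <-] => [/ab|/ba] [r or sr];
  exists r => //; apply/state_tuple_agree => i lt_i; rewrite nth_state_tuple ?sr.
Qed.

(** * Building codes of graphs *)

Definition edge : Type := nat * com * nat.

Definition ecode D (e : edge) := (com_code e.1.2 * D + e.2) * D + e.1.1.

Definition mk_graph D L u0 u1 :=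
  npair D.-1 ((CodeSeq.code L * D + u1) * D + u0).

Definition represents D (L : seq nat) (E : nat -> com -> nat -> Prop) :=
  forall z, z \in L <-> exists u c v, E u c v /\ z = ecode D (u, c, v).

Lemma gsize_mk D L u0 u1 : u0 < D -> gsize (mk_graph D L u0 u1) = D.
Proof. by move=> lt_u0; rewrite /gsize /mk_graph npairK prednK; lia. Qed.

Lemma gstart_mk D L u0 u1 : u0 < D -> gstart (mk_graph D L u0 u1) = u0.
Proof.
by move=> lt_u0; rewrite /gstart gsize_mk // /mk_graph npairK modnMDl modn_small.
Qed.

Lemma div_mk D L u0 u1 : u0 < D ->
  (nunpair (mk_graph D L u0 u1)).2 %/ D = CodeSeq.code L * D + u1.
Proof.
move=> lt_u0; rewrite /mk_graph npairK divnMDl ?(divn_small lt_u0) ?addn0 //.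
exact: leq_ltn_trans lt_u0.
Qed.

Lemma gstop_mk D L u0 u1 : u0 < D -> u1 < D -> gstop (mk_graph D L u0 u1) = u1.
Proof.
by move=> lt0 lt1; rewrite /gstop gsize_mk // div_mk // modnMDl modn_small.
Qed.

Lemma glist_mk D L u0 u1 : u0 < D -> u1 < D -> glist (mk_graph D L u0 u1) = L.
Proof.
move=> lt0 lt1; rewrite /glist gsize_mk // div_mk // divnMDl.
  by rewrite (divn_small lt1) addn0 CodeSeq.codeK.
exact: leq_ltn_trans lt0.
Qed.

Lemma gedge_mk D L u0 u1 (E : nat -> com -> nat -> Prop) u c v :
  u0 < D -> u1 < D -> represents D L E ->
  (forall u c v, E u c v -> u < D /\ v < D) ->
  gedge (mk_graph D L u0 u1) u c v <-> E u c v.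
Proof.
move=> lt0 lt1 L_E E_lt; have D_gt0 : 0 < D by apply: leq_ltn_trans lt0.
have decodeE u' c' v' : u' < D -> v' < D ->
  let z := ecode D (u', c', v') in
  [/\ z %% D = u', com_decode (z %/ D %/ D) = c' & z %/ D %% D = v'].
  move=> lt_u lt_v z; rewrite /z /ecode /= modnMDl !divnMDl // modn_small //.
  rewrite (divn_small lt_u) addn0 modnMDl divnMDl // modn_small //.
  by rewrite (divn_small lt_v) addn0 com_codeK.
rewrite /gedge glist_mk // gsize_mk //; split=> [[z]|Euv].
  move=> /L_E[u' [c' [v' [Euv ->]]]]; have [lt_u lt_v] := E_lt _ _ _ Euv.
  by have [-> -> ->] := decodeE _ c' _ lt_u lt_v => -[-> -> ->].
have [lt_u lt_v] := E_lt _ _ _ Euv; exists (ecode D (u, c, v)).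
  by apply/L_E; exists u, c, v.
by have [-> -> ->] := decodeE _ c _ lt_u lt_v.
Qed.

Lemma outcome_mk D L u0 u1 (E : nat -> com -> nat -> Prop) x s :
  u0 < D -> u1 < D -> represents D L E ->
  (forall u c v, E u c v -> u < D /\ v < D) ->
  outcome (mk_graph D L u0 u1) x s <-> reach E u0 (starts_with x) u1 s.
Proof.
move=> lt0 lt1 L_E E_lt; rewrite /outcome gstart_mk // gstop_mk //.
by split; apply: eq_reach => // u c v /gedge_mk; apply.
Qed.

Lemma represents_list D (l : seq edge) :
  represents D (map (ecode D) l) (fun u c v => (u, c, v) \in l).
Proof.
move=> z; split=> [/mapP[[[u c] v] e ->]|[u [c [v [e ->]]]]].
  by exists u, c, v.
by apply: map_f.
Qed.

Lemma represents_collect D L E N (l : nat -> seq edge) : represents D L E ->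
  represents D (collect N (fun i => map (ecode D) (l i)) L)
    (fun u c v => E u c v \/ exists2 i, i < N & (u, c, v) \in l i).
Proof.
move=> L_E z; rewrite mem_collect L_E; split.
  case=> [[u [c [v [e ->]]]]|[i [lt_i /mapP[[[u c] v] e ->]]]].
    by exists u, c, v; split=> //; left.
  by exists u, c, v; split=> //; right; exists i.
case=> u [c [v [[e|[i lt_i e]] ->]]]; first by left; exists u, c, v.
by right; exists i; split=> //; apply: map_f.
Qed.

Definition copied_edges a o i : seq edge :=
  if size (glist a) <= i then [::] else
  let z := (glist a)$i in
  [:: (z %% gsize a + o, com_decode (z %/ gsize a %/ gsize a),
       z %/ gsize a %% gsize a + o)].

(** The loop bound is the code of the edge list of [a], which is at least its length; [copied_edges]
    is empty past the end. The offset [o] keeps several copies disjoint. *)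
Definition copy_graph a D o L :=
  collect ((nunpair a).2 %/ gsize a %/ gsize a)
    (fun i => map (ecode D) (copied_edges a o i)) L.

Lemma represents_copy D L E a o : represents D L E ->
  represents D (copy_graph a D o L)
    (fun u c v => E u c v \/ exists u' v',
      [/\ gedge a u' c v', u = u' + o & v = v' + o]).
Proof.
move=> /(represents_collect ((nunpair a).2 %/ gsize a %/ gsize a)
  (copied_edges a o)) rep z.
rewrite rep; split=> -[u [c [v [e ->]]]]; exists u, c, v; split=> //.
  case: e => [|[i _]]; first by left.
  rewrite /copied_edges; case: leqP => // lt_i; rewrite mem_seq1.
  case/eqP=> -> -> ->; right; set z' := _$_.
  exists (z' %% gsize a), (z' %/ gsize a %% gsize a); split=> //.
  by exists z' => //; apply: mem_nth.
case: e => [|[u' [v' [[z' zL [-> -> ->]] -> ->]]]]; first by left.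
right; exists (index z' (glist a)).
  have := zL; rewrite -index_mem => /leq_trans; apply.
  by rewrite -[X in _ <= X]CodeSeq.decodeK size_le_code.
by rewrite /copied_edges leqNgt index_mem zL /= nth_index // mem_seq1.
Qed.

Lemma gedge_lt a u c v : gedge a u c v -> u < gsize a /\ v < gsize a.
Proof. by move=> [z _ [-> _ ->]]; rewrite !ltn_mod. Qed.

Lemma gstart_lt a : gstart a < gsize a. Proof. by rewrite ltn_mod. Qed.
Lemma gstop_lt a : gstop a < gsize a. Proof. by rewrite ltn_mod. Qed.

(** * Primitive recursive construction of graph codes *)

Lemma pr_comp4 F f g h k : pr (fun e => F e$0 e$1 e$2 e$3) ->
  pr f -> pr g -> pr h -> pr k -> pr (fun e => F (f e) (g e) (h e) (k e)).
Proof.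
move=> pF pf pg ph pk.
by apply: (pr_comp (gs := [:: f; g; h; k]) pF) => l /= [<-|[<-|[<-|[<-|]]]].
Qed.

Definition prc (c : seq nat -> com) := pr (fun e => com_code (c e)).

Definition pre D (l : seq nat -> seq edge) :=
  prl (fun e => map (ecode (D e)) (l e)).

Lemma pr_gsize f : pr f -> pr (fun e => gsize (f e)).
Proof. by move=> pf; apply/pr_succ/pr_nunpair1. Qed.

Lemma pr_gstart f : pr f -> pr (fun e => gstart (f e)).
Proof. by move=> pf; apply: pr_modn (pr_nunpair2 pf) (pr_gsize pf). Qed.

Lemma pr_gstop f : pr f -> pr (fun e => gstop (f e)).
Proof.
move=> pf; apply: pr_modn (pr_gsize pf).
exact: pr_divn (pr_nunpair2 pf) (pr_gsize pf).
Qed.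

Lemma prl_glist f : pr f -> prl (fun e => glist (f e)).
Proof.
move=> pf; apply: prl_decode; apply: pr_divn (pr_gsize pf).
exact: pr_divn (pr_nunpair2 pf) (pr_gsize pf).
Qed.

Lemma prc_const c : prc (fun=> c).
Proof. exact: pr_const. Qed.

Lemma prc_AssignZero f : pr f -> prc (fun e => AssignZero (f e)).
Proof. by move=> pf; apply: pr_muln (pr_const 5) pf. Qed.

Lemma pr_com_code k f g : pr f -> pr g ->
  pr (fun e => 5 * npair (f e) (g e) + k).
Proof.
move=> pf pg; apply: pr_addn (pr_const k).
exact: pr_muln (pr_const 5) (pr_npair pf pg).
Qed.

Lemma prc_AssignVar f g : pr f -> pr g -> prc (fun e => AssignVar (f e) (g e)).
Proof. exact: pr_com_code. Qed.

Lemma prc_AssignSucc f g : pr f -> pr g -> prc (fun e => AssignSucc (f e) (g e)).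
Proof. exact: pr_com_code. Qed.

Lemma prc_GuardVar f g : pr f -> pr g -> prc (fun e => GuardVar (f e) (g e)).
Proof. exact: pr_com_code. Qed.

Lemma prc_GuardCst f g : pr f -> pr g -> prc (fun e => GuardCst (f e) (g e)).
Proof. exact: pr_com_code. Qed.

Lemma prc_decode f : pr f -> prc (fun e => com_decode (f e)).
Proof. by move=> pf; apply: (eq_pr pf) => e; rewrite com_decodeK. Qed.

Lemma prc_if (b : seq nat -> bool) c c' : pr (fun e => b e) -> prc c -> prc c' ->
  prc (fun e => if b e then c e else c' e).
Proof.
by move=> pb pc pc'; apply: (eq_pr (pr_if pb pc pc')) => e /=; case: (b e).
Qed.

Lemma pre_nil D : pre D (fun=> [::]).
Proof. exact: prl_nil. Qed.

Lemma pre_cons D u c v l : pr D -> pr u -> prc c -> pr v -> pre D l ->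
  pre D (fun e => (u e, c e, v e) :: l e).
Proof.
move=> pD pu pc pv pl; apply: prl_cons pl; apply: pr_addn pu.
by apply: (pr_muln _ pD); apply: pr_addn pv; apply: pr_muln pc pD.
Qed.

Lemma pre_if (b : seq nat -> bool) D l l' : pr (fun e => b e) ->
  pre D l -> pre D l' -> pre D (fun e => if b e then l e else l' e).
Proof.
by move=> pb pl pl'; apply: (eq_pr (prl_if pb pl pl')) => e /=; case: (b e).
Qed.

Ltac pr_step := lazymatch goal with
| |- pr (fun e => nth 0 e _) => apply: pr_nth
| |- pr (fun e => S (@?f e)) => first [apply: pr_const | apply: pr_succ]
| |- pr (fun e => addn (@?f e) (@?g e)) => apply: pr_addn
| |- pr (fun e => subn (@?f e) (@?g e)) => apply: pr_subn
| |- pr (fun e => muln (@?f e) (@?g e)) => apply: pr_muln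
| |- pr (fun e => divn (@?f e) (@?g e)) => apply: pr_divn
| |- pr (fun e => modn (@?f e) (@?g e)) => apply: pr_modn
| |- pr (fun e => predn (@?f e)) => apply: pr_predn
| |- pr (fun e => npair (@?f e) (@?g e)) => apply: pr_npair
| |- pr (fun e => fst (nunpair (@?f e))) => apply: pr_nunpair1
| |- pr (fun e => snd (nunpair (@?f e))) => apply: pr_nunpair2
| |- pr (fun e => gsize (@?f e)) => apply: pr_gsize
| |- pr (fun e => gstart (@?f e)) => apply: pr_gstart
| |- pr (fun e => gstop (@?f e)) => apply: pr_gstop
| |- pr (fun e => nat_of_bool (eq_op (@?f e) (@?g e))) => apply: pr_eq
| |- pr (fun e => nat_of_bool (leq (size (@?f e)) (@?g e))) =>
    apply: pr_size_leq
| |- pr (fun e => nat_of_bool (leq (@?f e) (@?g e))) => apply: pr_leq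
| |- pr (fun e => CodeSeq.code (@?f e)) => change (prl f)
| |- pr (fun e => nth 0 (@?f e) (@?g e)) => apply: pr_nth_list
| |- pr (fun e => ?n) => apply: pr_const
| |- prc (fun e => AssignZero (@?f e)) => apply: prc_AssignZero
| |- prc (fun e => AssignVar (@?f e) (@?g e)) => apply: prc_AssignVar
| |- prc (fun e => AssignSucc (@?f e) (@?g e)) => apply: prc_AssignSucc
| |- prc (fun e => GuardVar (@?f e) (@?g e)) => apply: prc_GuardVar
| |- prc (fun e => GuardCst (@?f e) (@?g e)) => apply: prc_GuardCst
| |- prc (fun e => com_decode (@?f e)) => apply: prc_decode
| |- prc _ => first [apply: prc_const | apply: prc_if]
| |- prl (fun e => CodeSeq.decode (@?f e)) => apply: prl_decode
| |- prl (fun e => glist (@?f e)) => apply: prl_glist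
| |- prl (fun e => map (ecode (@?D e)) (@?f e)) => change (pre D f)
| |- pre _ (fun e => nil) => apply: pre_nil
| |- pre _ (fun e => cons (@?f e) (@?g e)) => apply: pre_cons
| |- pre _ (fun e => map _ _) => progress cbn [map]
| |- pre _ _ => apply: pre_if
end.
Ltac pr_tac := repeat pr_step.

Lemma prl_copy a D o l : pr a -> pr D -> pr o -> prl l ->
  prl (fun e => copy_graph (a e) (D e) (o e) (l e)).
Proof.
move=> pa pD po pl.
(* The list argument is passed as a code, so that [F] is a function of numbers and composition
   applies. Below, [a], [D], [o] are [e$2], [e$3], [e$4] inside the loop body, after the index and
   the dummy. *)
pose F a D o l := CodeSeq.code (copy_graph a D o (CodeSeq.decode l)).
suff pF : pr (fun e => F e$0 e$1 e$2 e$3).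
  by apply: (eq_pr (pr_comp4 pF pa pD po pl)) => e; rewrite /F CodeSeq.codeK.
apply: (prl_collect
  (N := fun e => (nunpair e$0).2 %/ gsize e$0 %/ gsize e$0)
  (F := fun e => map (ecode e$3) (copied_edges e$2 e$4 e$0))
  (G := fun e => CodeSeq.decode e$3)) => //; rewrite /copied_edges; pr_tac.
Qed.

Lemma pr_mk_graph D l u0 u1 : pr D -> prl l -> pr u0 -> pr u1 ->
  pr (fun e => mk_graph (D e) (l e) (u0 e) (u1 e)).
Proof. by move=> pD pl p0 p1; rewrite /mk_graph; pr_tac. Qed.

(** * Discharging and branching *)

Definition noop := AssignVar 0 0.

Lemma cexec_noop s : cexec noop s = Some s.
Proof.
by congr Some; apply/funext => i; rewrite /upd; case: eqP => [->|].
Qed.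

(** New nodes lie from [D] on and enter the old ones only at [sa], and no old edge leads back. Hence
    a run ending below [D] is a run through the new part to [sa] followed by a run of the old
    graph. *)
Lemma reach_low D (Ea En : nat -> com -> nat -> Prop) sa s0 I v s :
  (forall u c v, Ea u c v -> u < D /\ v < D) ->
  (forall u c v, En u c v -> D <= u /\ (D <= v \/ v = sa)) ->
  D <= s0 -> sa < D -> v < D ->
  reach (fun u c v => En u c v \/ Ea u c v) s0 I v s <->
  reach Ea sa (reach En s0 I sa) v s.
Proof.
move=> Ea_lt En_ge le_s0 lt_sa lt_v; split=> [us|].
  suff [] : (v < D -> reach Ea sa (reach En s0 I sa) v s) /\
            (D <= v -> reach En s0 I v s) by move=> /(_ lt_v).
  elim: us {lt_v} => {v s} [s Is|u c v s s' _ [IHa IHn] [e|e] cs].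
  - by split=> [|_]; [lia | apply: reach_start].
  - have [le_u v_or] := En_ge _ _ _ e.
    have us' : reach En s0 I v s' by apply: reach_edge (IHn le_u) e cs.
    split=> // lt_v; case: v_or => [|eq_v]; first by lia.
    by rewrite eq_v in us' *; apply: reach_start.
  - have [lt_u lt_v] := Ea_lt _ _ _ e; split; last by lia.
    by move=> _; apply: reach_edge (IHa lt_u) e cs.
elim=> {v s lt_v} [s|u c v s s' _ IH e cs].
  by apply: eq_reach => // u c v; left.
by apply: reach_edge IH _ cs; right.
Qed.

(** A straight line of commands from [C] to [C + N]. At the last node the [loop] commands may be
    repeated before the exit; such a loop generates arbitrary values. *)
Definition chain_edge C N (cf : nat -> com) (loop : com -> Prop) tgt u c v :=
  (u = C + N /\ (c = noop /\ v = tgt \/ loop c /\ v = C + N)) \/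
  exists2 j, j < N & [/\ u = C + j, c = cf j & v = C + j.+1].

(** A Hoare-style rule: [P j] is the assertion at node [C + j], and [P N] is the loop invariant. As
    [tgt < C], the exit is not a node of the chain. *)
Lemma chain_sound C N cf loop tgt (I : regs -> Prop) (P : nat -> regs -> Prop) s :
  tgt < C -> (forall s, I s -> P 0 s) ->
  (forall j s s', j < N -> P j s -> cexec (cf j) s = Some s' -> P j.+1 s') ->
  (forall c s s', loop c -> P N s -> cexec c s = Some s' -> P N s') ->
  reach (chain_edge C N cf loop tgt) C I tgt s -> P N s.
Proof.
move=> lt_tgt I_P0 P_step P_loop.
suff gen v : reach (chain_edge C N cf loop tgt) C I v s ->
    (forall j, j <= N -> v = C + j -> P j s) /\ (v = tgt -> P N s).
  by move=> /gen[_]; apply.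
elim=> {v s} [s Is|u c v s s' _ [IH _] e cs].
  split=> [j _ eq_j|]; last by lia.
  by have -> : j = 0 by [lia]; apply: I_P0.
case: e => [[eq_u [[eq_c eq_v]|[loop_c eq_v]]]|[j lt_j [eq_u eq_c eq_v]]].
- move: cs; rewrite eq_c cexec_noop => -[<-].
  split=> [j le_j|_]; [lia | exact: IH].
- split=> [j le_j|]; last by lia.
  rewrite eq_v => /addnI <-; apply: P_loop loop_c _ cs; exact: IH.
- split=> [k le_k|]; last by lia.
  rewrite eq_v => /addnI <-; rewrite eq_c in cs; apply: (P_step _ _ _ lt_j _ cs).
  exact: IH (ltnW lt_j) eq_u.
Qed.

Lemma chain_run C N cf loop tgt (I : regs -> Prop) (f : nat -> regs) j :
  I (f 0) -> (forall j, j < N -> cexec (cf j) (f j) = Some (f j.+1)) -> j <= N ->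
  reach (chain_edge C N cf loop tgt) C I (C + j) (f j).
Proof.
move=> I0 cf_f; elim: j => [_|j IH lt_j].
  by rewrite addn0; apply: reach_start.
apply: reach_edge (IH (ltnW lt_j)) _ (cf_f j lt_j).
by right; exists j.
Qed.

Lemma chain_exit C N cf loop tgt (I : regs -> Prop) s :
  reach (chain_edge C N cf loop tgt) C I (C + N) s ->
  reach (chain_edge C N cf loop tgt) C I tgt s.
Proof.
by move=> us; apply: reach_edge us _ (cexec_noop s); left; split=> //; left.
Qed.

Definition chain_list D C N cf (loops : seq com) tgt :=
  collect N (fun i => map (ecode D) [:: (C + i, cf i, C + i.+1)])
    (map (ecode D) ((C + N, noop, tgt) :: [seq (C + N, c, C + N) | c <- loops])).

Lemma represents_chain D C N cf loops tgt :
  represents D (chain_list D C N cf loops tgt)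
    (chain_edge C N cf (fun c => c \in loops) tgt).
Proof.
move=> z; rewrite (represents_collect _ _ (represents_list _ _)).
split=> -[u [c [v [e ->]]]]; exists u, c, v; split=> //.
  case: e => [|[i lt_i]]; last first.
    by rewrite mem_seq1 => /eqP[-> -> ->]; right; exists i.
  rewrite inE => /orP[/eqP[-> -> ->]|/mapP[c' c'l [-> -> ->]]].
    by left; split=> //; left.
  by left; split=> //; right.
case: e => [[-> [[-> ->]|[cl ->]]]|[i lt_i [-> -> ->]]].
- by left; rewrite mem_head.
- by left; rewrite inE orbC; apply/orP; left; apply/mapP; exists c.
- by right; exists i => //; rewrite mem_seq1.
Qed.

Lemma chain_edge_lt C N cf loop tgt u c v : tgt < C ->
  chain_edge C N cf loop tgt u c v ->
  C <= u /\ (C <= v \/ v = tgt) /\ u <= C + N /\ v <= C + N.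
Proof. by move=> lt_t [[-> [[_ ->]|[_ ->]]]|[j lt_j [-> _ ->]]]; lia. Qed.

(** * Discharging *)

Definition discharge_com n j := if j < n then AssignVar j j.+1 else AssignZero n.

Definition discharge_graph n a :=
  let D := gsize a + n.+2 in
  mk_graph D (copy_graph a D 0 (chain_list D (gsize a) n.+1 (discharge_com n)
    [:: AssignSucc n n] (gstart a))) (gsize a) (gstop a).

Lemma pr_discharge n : pr (fun e => discharge_graph n e$0).
Proof.
apply: pr_mk_graph; [pr_tac|apply: prl_copy; pr_tac|pr_tac|pr_tac].
apply: (prl_collect
  (F := fun e => map (ecode (gsize e$2 + n.+2))
    [:: (gsize e$2 + e$0, discharge_com n e$0, gsize e$2 + (e$0).+1)])) => //.
- pr_tac.
- by rewrite /discharge_com; pr_tac.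
- by pr_tac.
Qed.

Lemma gedge0 a u c v :
  (exists u' v', [/\ gedge a u' c v', u = u' + 0 & v = v' + 0]) <-> gedge a u c v.
Proof.
split=> [[u' [v' [e -> ->]]]|e]; first by rewrite !addn0.
by exists u, v; rewrite !addn0.
Qed.

(** The commands run upwards, so variable [j.+1] is read before it is overwritten. Variables above
    [n] keep their arbitrary values, so the outcomes coincide exactly and not only on a prefix. *)
Lemma discharge_outcome n a x (y : n.-tuple nat) s :
  outcome (discharge_graph n a) (x :: y) s <-> outcome a y s.
Proof.
set C := gsize a; set E := chain_edge C n.+1 (discharge_com n)
  (fun c => c \in [:: AssignSucc n n]) (gstart a).
have lt_sa : gstart a < C := gstart_lt a.
rewrite /discharge_graph -/C; rewrite (outcome_mk (E := fun u c v =>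
  E u c v \/ gedge a u c v)); first last.
- move=> u c v [/(chain_edge_lt lt_sa)|/gedge_lt]; lia.
- move=> z; rewrite (represents_copy _ _ (represents_chain _ _ _ _ _ _)).
  split=> -[u [c [v [e ->]]]]; exists u, c, v; split=> //.
    by case: e => [|/gedge0]; [left|right].
  by case: e => [|/gedge0]; [left|right].
- by have := gstop_lt a; lia.
- by lia.
rewrite (@reach_low C _ _ (gstart a)) //; first last.
- exact: gstop_lt.
- by move=> u c v /(chain_edge_lt lt_sa); lia.
- exact: gedge_lt.
suff init r : reach E C (starts_with (x :: y)) (gstart a) r <-> starts_with y r.
  by split; apply: eq_reach => // r /init.
split=> [us|].
  pose P j (r : regs) := forall i, i < n ->
    (i < j -> r i = (tval y)$i) /\ (j <= i.+1 -> r i.+1 = (tval y)$i).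
  suff Pr : P n.+1 r.
    by move=> i; rewrite size_tuple => lt_i; apply: (Pr i lt_i).1; apply: leqW.
  apply: (chain_sound lt_sa _ _ _ us).
- move=> r1 xr i lt_i; split=> // _.
  by rewrite (xr i.+1) //= ltnS size_tuple.
- rewrite /discharge_com => j r1 r2 lt_j Pr.
  case: ltnP => [lt_jn|le_nj] [<-] i lt_i; have [Pr1 Pr2] := Pr i lt_i.
    split=> [lt_ij|le_ji]; last by rewrite upd_other; [apply: Pr2; lia|lia].
    case: (eqVneq i j) => [->|neq].
      by rewrite upd_same; apply: (Pr j lt_jn).2; lia.
    by rewrite upd_other; [apply: Pr1; lia|lia].
  split=> [lt_ij|]; last by lia.
  by rewrite upd_other; [apply: Pr1; lia|lia].
- move=> c r1 r2; rewrite mem_seq1 => /eqP -> Pr [<-] i lt_i; split; last by lia.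
  by move=> lt_in; rewrite upd_other; [apply: (Pr i lt_i).1|lia].
move=> yr; apply: chain_exit.
(* The initial state leading to [r]: the discarded input [x], then [r] moved up by one place, and
   [r] itself above variable [n]. [f j] is the state after [j] commands. *)
pose r0 i := if i is i'.+1 then (if i' < n then r i' else r i) else x.
pose f j := if j <= n then (fun i => if i < j then r i else r0 i) else upd r n 0.
have : reach E C (starts_with (x :: y)) (C + n.+1) (f n.+1).
  apply: chain_run => //.
    move=> [|i] //=; rewrite ltnS size_tuple => lt_i.
    by rewrite /f /= lt_i yr ?size_tuple.
  move=> j; rewrite ltnS /discharge_com /f => le_jn; rewrite le_jn.
  case: (ltnP j n) => [lt_jn|le_nj]; congr Some; apply/funext => i.
    rewrite /upd ltnS; case: (eqVneq i j) => [->|neq].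
      by rewrite ltnNge leqnSn leqnn /= lt_jn.
    by rewrite ltn_neqAle neq.
  have -> : j = n by lia.
  rewrite /upd; case: (eqVneq i n) => // neq.
  case: ltnP => // le_ni; case: i neq le_ni => [|i] /=; first by lia.
  by case: (ltnP i n) => //; lia.
rewrite /f ltnn.
(* After the reset variable [n] is 0; [r n] rounds of the loop give it the value required by [r]. *)
suff loop k : reach E C (starts_with (x :: y)) (C + n.+1) (upd r n 0) ->
    reach E C (starts_with (x :: y)) (C + n.+1) (upd r n k).
  move=> /(loop (r n)); congr reach; apply/funext => i.
  by rewrite /upd; case: eqP => [->|].
move=> us; elim: k => // k IH.
apply: (reach_edge (c := AssignSucc n n)) IH _ _.
  by left; split=> //; right; rewrite mem_seq1.
by congr Some; apply/funext => i; rewrite /upd; case: eqP => //; rewrite eqxx.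
Qed.

Lemma discharging_state t (Q : set (set (t.-tuple nat))) :
  discharging (state_semantics Q).
Proof.
move=> n _; exists (fun e : 1.-tuple nat => discharge_graph n (tval e)$0); split.
  exact: (@pr_computable (fun e => discharge_graph n e$0) 1 (pr_discharge n)).
move=> a x; apply/funext => y /=.
by apply: eq_state_den => s os; exists s => //; apply/(discharge_outcome a x y s).
Qed.

(** * Branching *)

Definition branch_graph a b c1 c2 :=
  let k := gsize a + gsize b in let D := k.+2 in
  mk_graph D (copy_graph a D 0 (copy_graph b D (gsize a) (map (ecode D)
    [:: (k, GuardCst 0 c1, gstart a); (k, GuardCst 0 c2, gstart b + gsize a);
        (gstop a, noop, k.+1); (gstop b + gsize a, noop, k.+1)]))) k k.+1.

Lemma pr_branch : pr (fun e => branch_graph e$0 e$1 e$2 e$3).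
Proof.
apply: pr_mk_graph; [pr_tac|apply: prl_copy; pr_tac|pr_tac|pr_tac].
by apply: prl_copy; rewrite /noop; pr_tac.
Qed.

(** No edge joins the two copies, so the outcomes form a union, each half guarded by a test of [x];
    distinct constants later leave at most one half. A graph has a single stop node, so both old
    ones lead by [noop] to a fresh one. *)
Lemma branch_outcome a b c1 c2 x (y : seq nat) s :
  outcome (branch_graph a b c1 c2) (x :: y) s <->
  x = c1 /\ outcome a (x :: y) s \/ x = c2 /\ outcome b (x :: y) s.
Proof.
set k := gsize a + gsize b.
pose l : seq edge :=
  [:: (k, GuardCst 0 c1, gstart a); (k, GuardCst 0 c2, gstart b + gsize a);
      (gstop a, noop, k.+1); (gstop b + gsize a, noop, k.+1)].
pose E u c v := ((u, c, v) \in l \/ exists u' v',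
  [/\ gedge b u' c v', u = u' + gsize a & v = v' + gsize a]) \/ gedge a u c v.
have [sa ta] := (gstart_lt a, gstop_lt a); have [sb tb] := (gstart_lt b, gstop_lt b).
rewrite /branch_graph -/k (outcome_mk (E := E)) //; first last.
- move=> u c v [[|[u' [v' [/gedge_lt[lt_u lt_v] -> ->]]]]|/gedge_lt]; last by lia.
    by rewrite !inE => /or4P[] /eqP[-> _ ->]; lia.
  by lia.
- move=> z; rewrite (represents_copy _ _ (represents_copy _ _
    (represents_list _ _))).
  split=> -[u [c [v [e ->]]]]; exists u, c, v; split=> //.
    by case: e => [|/gedge0]; [left|right].
  by case: e => [|/gedge0]; [left|right].
have x0 r : starts_with (x :: y) r -> r 0 = x by move=> /(_ 0 isT).
split=> [us|].
  (* One clause for each kind of node: the copy of [a], the shifted copy of [b], the fresh start and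
     the fresh stop. *)
  pose Inv v r := [/\ v < gsize a -> x = c1 /\
      reach (gedge a) (gstart a) (starts_with (x :: y)) v r,
    forall v', v' < gsize b -> v = v' + gsize a -> x = c2 /\
      reach (gedge b) (gstart b) (starts_with (x :: y)) v' r,
    v = k -> starts_with (x :: y) r &
    v = k.+1 ->
      x = c1 /\ outcome a (x :: y) r \/ x = c2 /\ outcome b (x :: y) r].
  suff [_ _ _] : Inv k.+1 s by apply.
  elim: us => {s} [s Is|u c v s s' _ [IHa IHb IHk _] e cs].
    by split=> // [|v'|]; lia.
  case: e => [[|[u' [v' [e eq_u eq_v]]]]|e]; last first.
  - have [lt_u lt_v] := gedge_lt e; split=> [_|v''||]; try lia.
    have [-> us] := IHa lt_u; split=> //; exact: reach_edge us e cs.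
  - have [lt_u lt_v] := gedge_lt e; split=> [|v'' lt_v''||]; try lia.
    rewrite eq_v => /addIn <-; have [-> us] := IHb _ lt_u eq_u; split=> //.
    exact: reach_edge us e cs.
  rewrite !inE => /or4P[] /eqP[eq_u eq_c eq_v]; rewrite eq_c in cs.
  - move: cs => /=; case: eqP => // eq_0 [<-]; have Is := IHk eq_u.
    split=> [_|v''||]; try lia; rewrite -eq_0 (x0 _ Is); split=> //.
    by rewrite eq_v; apply: reach_start.
  - move: cs => /=; case: eqP => // eq_0 [<-]; have Is := IHk eq_u.
    split=> [|v'' lt_v''||]; try lia.
    rewrite eq_v -eq_0 (x0 _ Is) => /addIn <-; split=> //.
    exact: reach_start.
  - move: cs; rewrite cexec_noop => -[<-]; split=> [|v''||_]; try lia.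
    by left; rewrite eq_u in IHa; apply: IHa.
  - move: cs; rewrite cexec_noop => -[<-]; split=> [|v'' lt_v''||_]; try lia.
    by right; apply: (IHb _ tb).
have start r : starts_with (x :: y) r -> reach E k (starts_with (x :: y)) k r.
  exact: reach_start.
case=> [[eq_x os]|[eq_x os]].
  apply: (reach_edge (u := gstop a) (c := noop) (s := s)); last exact: cexec_noop.
    elim: os => {s} [s Is|u c v s s' _ IH e cs].
      apply: (reach_edge (c := GuardCst 0 c1) (start s Is)).
        by left; left; rewrite !inE eqxx.
      by rewrite /= (x0 s Is) eq_x eqxx.
    by apply: reach_edge IH _ cs; right.
  by left; left; rewrite !inE eqxx ?orbT.
apply: (reach_edge (u := gstop b + gsize a) (c := noop) (s := s)).
- elim: os => {s} [s Is|u c v s s' _ IH e cs].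
    apply: (reach_edge (c := GuardCst 0 c2) (start s Is)).
      by left; left; rewrite !inE eqxx ?orbT.
    by rewrite /= (x0 s Is) eq_x eqxx.
  by apply: reach_edge IH _ cs; left; right; exists u, v.
- by left; left; rewrite !inE eqxx ?orbT.
- exact: cexec_noop.
Qed.

Lemma branching_state t (Q : set (set (t.-tuple nat))) :
  branching (state_semantics Q).
Proof.
move=> n; pose f e := branch_graph e$0 e$1 e$2 e$3.
exists (fun e : 4.-tuple nat => f e); split; first exact: pr_computable pr_branch.
move=> a b c1 c2 x neq_c; have [eq_1|/eqP neq_1] := eqVneq x c1;
  last have [eq_2|/eqP neq_2] := eqVneq x c2; apply/funext => y.
- apply: eq_state_den => s os; exists s => //; last by apply/branch_outcome; left.
  by case/branch_outcome: os => -[] // eq_2; case: neq_c; rewrite -eq_1.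
- apply: eq_state_den => s os; exists s => //; last by apply/branch_outcome; right.
  by case/branch_outcome: os => -[].
- by apply: state_den_None => s /branch_outcome[] [].
Qed.

(** * Simulating URMs by graphs *)

(** Variable [A] is scratch and [A.+1 + j] holds register [j]. Node [k + i] stands for address [i];
    an address outside the program writes the result to variable 0 and leaves for [sa]. At a jump,
    [k + T + i] and [k + 2 * T + i] are the waiting loops for the first register being smaller or
    larger; only the correct one can be left. *)
Definition urm_edges k T A sa (p : program) i : seq edge :=
  match onth p i with
  | None => [:: (k + i, AssignVar 0 A.+1, sa)]
  | Some (Zero n) => [:: (k + i, AssignZero (A.+1 + n), k + i.+1)]
  | Some (Succ n) =>
      [:: (k + i, AssignSucc (A.+1 + n) (A.+1 + n), k + i.+1)]
  | Some (Transfer m n) =>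
      [:: (k + i, AssignVar (A.+1 + n) (A.+1 + m), k + i.+1)]
  | Some (Jump m n q) =>
      [:: (k + i, GuardVar (A.+1 + m) (A.+1 + n), k + q);
          (k + i, AssignSucc A (A.+1 + m), k + T + i);
          (k + T + i, AssignSucc A A, k + T + i);
          (k + T + i, GuardVar A (A.+1 + n), k + i.+1);
          (k + i, AssignSucc A (A.+1 + n), k + 2 * T + i);
          (k + 2 * T + i, AssignSucc A A, k + 2 * T + i);
          (k + 2 * T + i, GuardVar A (A.+1 + m), k + i.+1)]
  end.

Definition instr_bounded K T (ins : instr) :=
  match ins with
  | Zero n => n < K
  | Succ n => n < K
  | Transfer m n => (m < K) && (n < K)
  | Jump m n q => [&& m < K, n < K & q < T]
  end.

Definition urm_edge k T A sa p u c v :=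
  exists2 i, i < T & (u, c, v) \in urm_edges k T A sa p i.

Definition holds_regs A K (r s : regs) := forall j, j < K -> s (A.+1 + j) = r j.

Lemma holds_regs_upd A K r s j v :
  holds_regs A K r s -> holds_regs A K (upd r j v) (upd s (A.+1 + j) v).
Proof. by move=> rs i lt_i; rewrite /upd eqn_add2l rs. Qed.

Lemma holds_regs_low A K r s j v : j <= A ->
  holds_regs A K r s -> holds_regs A K r (upd s j v).
Proof. by move=> le_j rs i lt_i; rewrite upd_other ?rs //; lia. Qed.

Lemma agree_upd A s s' j v : A <= j -> agree A s s' -> agree A s (upd s' j v).
Proof. by move=> le_j ss' i lt_i; rewrite upd_other ?ss' //; lia. Qed.

Lemma step_at (p : program) i ins r : onth p i = Some ins ->
  step p (i, r) = match ins with
    | Zero n => (i.+1, upd r n 0)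
    | Succ n => (i.+1, upd r n (r n).+1)
    | Transfer m n => (i.+1, upd r n (r m))
    | Jump m n q => (if r m == r n then q else i.+1, r)
    end.
Proof. by rewrite /step => ->. Qed.

Section Simulation.

Variables (k T A sa K : nat) (p : program) (m : nat) (x : m.-tuple nat).
Variable J : regs -> Prop.
Hypotheses (lt_sa : sa < k) (size_p : size p < T) (K_gt0 : 0 < K).
Hypothesis p_bounded :
  forall i ins, onth p i = Some ins -> instr_bounded K T ins.
Hypothesis J_regs : forall s, J s -> holds_regs A K (fun i => nth 0 x i) s.

Let E := urm_edge k T A sa p.

Lemma onth_lt i ins : onth p i = Some ins -> i.+1 < T.
Proof.
move=> at_i; have : i < size p by rewrite -onthTE at_i.
lia.
Qed.

Lemma urm_edge_lt u c v : E u c v ->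
  k <= u < k + 3 * T /\ (k <= v < k + 3 * T \/ v = sa).
Proof.
move=> [i lt_i]; rewrite /urm_edges; case at_i: (onth p i) => [ins|]; last first.
  by rewrite mem_seq1 => /eqP[-> _ ->]; lia.
have := onth_lt at_i; have := p_bounded at_i.
case: ins at_i => [n|n|n1 n2|n1 n2 q] at_i /=; try
  by rewrite mem_seq1 => ? ? /eqP[-> _ ->]; lia.
case/and3P=> lt1 lt2 lt_q lt_i1; rewrite !inE.
by do ![case/orP]; move=> /eqP[-> _ ->]; lia.
Qed.

(** The initial state [s1] is remembered because the variables below [A] have to come out of the
    simulation unchanged. *)
Definition at_config i r s := exists s1 h,
  [/\ J s1, run p x h = (i, r), holds_regs A K r s & agree A s1 s].

Lemma at_config_step i r s i' r' s' : at_config i r s ->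
  step p (i, r) = (i', r') -> holds_regs A K r' s' -> agree A s s' ->
  at_config i' r' s'.
Proof.
move=> [s1 [h [Js1 run_h rs s1s]]] stepE r's' ss'.
exists s1, h.+1; split=> // [|j lt_j]; last by rewrite s1s ?ss'.
by rewrite /run iterS -/(run p x h) run_h.
Qed.

Lemma at_config_scratch i r s v : at_config i r s -> at_config i r (upd s A v).
Proof.
move=> [s1 [h [Js1 run_h rs s1s]]]; exists s1, h; split=> //.
  exact: holds_regs_low.
exact: agree_upd.
Qed.

(** One clause for each kind of node. In a waiting loop only a strict lower bound on the scratch
    variable is kept; increments preserve it. *)
Definition urm_inv v s := [/\
  forall i, i < T -> v = k + i -> exists r, at_config i r s,
  forall i, i < T -> v = k + T + i -> exists n1 n2 q r,
    [/\ onth p i = Some (Jump n1 n2 q), at_config i r s & r n1 < s A],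
  forall i, i < T -> v = k + 2 * T + i -> exists n1 n2 q r,
    [/\ onth p i = Some (Jump n1 n2 q), at_config i r s & r n2 < s A] &
  v = sa -> exists i r s', [/\ onth p i = None, at_config i r s' &
    s = upd s' 0 (r 0)]].

Lemma urm_inv_pc i r s : i < T -> at_config i r s -> urm_inv (k + i) s.
Proof.
move=> lt_i conf; split=> [j _ /addnI <-|j|j|]; try lia.
by exists r.
Qed.

Lemma urm_inv_aux1 i n1 n2 q r s : i < T -> onth p i = Some (Jump n1 n2 q) ->
  at_config i r s -> r n1 < s A -> urm_inv (k + T + i) s.
Proof.
move=> lt_i at_i conf lt_A; split=> [j|j _ /addnI <-|j|]; try lia.
by exists n1, n2, q, r.
Qed.

Lemma urm_inv_aux2 i n1 n2 q r s : i < T -> onth p i = Some (Jump n1 n2 q) ->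
  at_config i r s -> r n2 < s A -> urm_inv (k + 2 * T + i) s.
Proof.
move=> lt_i at_i conf lt_A; split=> [j|j|j _ /addnI <-|]; try lia.
by exists n1, n2, q, r.
Qed.

Lemma urm_reach_inv v s : reach E k J v s -> urm_inv v s.
Proof.
elim=> {v s} [s Js|u c v s s' _ [inv_pc inv1 inv2 _] [i lt_i e] cs].
  rewrite -[k]addn0; apply: (@urm_inv_pc _ (fun i => nth 0 x i)); first by lia.
  by exists s, 0; split=> //; apply: J_regs.
move: e; rewrite /urm_edges; case at_i: (onth p i) => [ins|]; last first.
  rewrite mem_seq1 => /eqP[eq_u eq_c ->]; move: cs; rewrite eq_c => -[<-].
  have [r conf] := inv_pc i lt_i eq_u; split=> [j|j|j|_]; try lia.
  exists i, r, s; split=> //; case: conf => [s1 [h [_ _ rs _]]].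
  by rewrite -[A.+1]addn0 rs.
have lt_i1 := onth_lt at_i; have := p_bounded at_i.
have stepE r := step_at r at_i.
case: ins at_i stepE => [n|n|n1 n2|n1 n2 q] at_i stepE /=.
- move=> lt_n; rewrite mem_seq1 => /eqP[eq_u eq_c ->].
  move: cs; rewrite eq_c => -[<-]; have [r conf] := inv_pc i lt_i eq_u.
  apply: (urm_inv_pc lt_i1); apply: (at_config_step conf (stepE r)).
    by case: conf => [s1 [h [_ _ rs _]]]; apply: holds_regs_upd.
  by apply: agree_upd => //; lia.
- move=> lt_n; rewrite mem_seq1 => /eqP[eq_u eq_c ->].
  move: cs; rewrite eq_c => -[<-]; have [r conf] := inv_pc i lt_i eq_u.
  apply: (urm_inv_pc lt_i1); apply: (at_config_step conf (stepE r)).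
    by case: conf => [s1 [h [_ _ rs _]]]; rewrite rs //; apply: holds_regs_upd.
  by apply: agree_upd => //; lia.
- case/andP=> lt1 lt2; rewrite mem_seq1 => /eqP[eq_u eq_c ->].
  move: cs; rewrite eq_c => -[<-]; have [r conf] := inv_pc i lt_i eq_u.
  apply: (urm_inv_pc lt_i1); apply: (at_config_step conf (stepE r)).
    by case: conf => [s1 [h [_ _ rs _]]]; rewrite rs //; apply: holds_regs_upd.
  by apply: agree_upd => //; lia.
case/and3P=> lt1 lt2 lt_q; rewrite !inE.
have conf_eq r j : at_config i r s -> j < K -> s (A.+1 + j) = r j.
  by move=> [s1 [h [_ _ rs _]]] /rs.
have jump r i' : at_config i r s ->
    (if r n1 == r n2 then q else i.+1) = i' -> at_config i' r s.
  move=> conf eq_i'; apply: (at_config_step conf _ _ (fun j _ => erefl)).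
    by rewrite (stepE r) eq_i'.
  by case: conf => [s1 [h []]].
case/orP=> [/eqP[eq_u eq_c ->]|].
  move: cs; rewrite eq_c /=; case: eqP => // + [<-].
  have [r conf] := inv_pc i lt_i eq_u.
  rewrite !(conf_eq _ _ conf) // => eq12; apply: (urm_inv_pc lt_q).
  by apply: (jump r _ conf); rewrite eq12 eqxx.
case/orP=> [/eqP[eq_u eq_c ->]|].
  move: cs; rewrite eq_c /= => -[<-]; have [r conf] := inv_pc i lt_i eq_u.
  rewrite (conf_eq _ _ conf) //.
  apply: (urm_inv_aux1 lt_i at_i (at_config_scratch _ conf)).
  by rewrite upd_same.
case/orP=> [/eqP[eq_u eq_c ->]|].
  move: cs; rewrite eq_c /= => -[<-].
  have [n1' [n2' [q' [r [at_i' conf lt_A]]]]] := inv1 i lt_i eq_u.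
  apply: (urm_inv_aux1 lt_i at_i' (at_config_scratch _ conf)).
  by rewrite upd_same; lia.
case/orP=> [/eqP[eq_u eq_c ->]|].
  move: cs; rewrite eq_c /=; case: eqP => // + [<-].
  have [n1' [n2' [q' [r]]]] := inv1 i lt_i eq_u.
  rewrite at_i => -[[eq1 _ _] conf]; rewrite -eq1 => lt_A.
  (* The invariant gives [r n1 < s A] and the guard [s A = r n2], so the registers differ and the
     URM proceeds to [i.+1] as well. *)
  rewrite (conf_eq _ _ conf) // => eqA; apply: (urm_inv_pc lt_i1).
  apply: (jump r _ conf); case: eqP => //; lia.
case/orP=> [/eqP[eq_u eq_c ->]|].
  move: cs; rewrite eq_c /= => -[<-]; have [r conf] := inv_pc i lt_i eq_u.
  rewrite (conf_eq _ _ conf) //.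
  apply: (urm_inv_aux2 lt_i at_i (at_config_scratch _ conf)).
  by rewrite upd_same.
case/orP=> [/eqP[eq_u eq_c ->]|].
  move: cs; rewrite eq_c /= => -[<-].
  have [n1' [n2' [q' [r [at_i' conf lt_A]]]]] := inv2 i lt_i eq_u.
  apply: (urm_inv_aux2 lt_i at_i' (at_config_scratch _ conf)).
  by rewrite upd_same; lia.
case/eqP=> eq_u eq_c ->.
move: cs; rewrite eq_c /=; case: eqP => // + [<-].
have [n1' [n2' [q' [r]]]] := inv2 i lt_i eq_u.
rewrite at_i => -[[_ eq2 _] conf]; rewrite -eq2 => lt_A.
rewrite (conf_eq _ _ conf) // => eqA; apply: (urm_inv_pc lt_i1).
apply: (jump r _ conf); case: eqP => //; lia.
Qed.

(** [sa] is entered only from addresses outside the program, where the simulated URM has halted. *)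
Lemma urm_sound s : 0 < A -> reach E k J sa s -> exists s1 z,
  [/\ J s1, urm_fun p x = Some z & agree A (upd s1 0 z) s].
Proof.
move=> A_gt0 /urm_reach_inv[_ _ _ /(_ erefl)].
move=> [i [r [s' [at_i [s1 [h [Js1 run_h _ s1s']]] ->]]]].
exists s1, (r 0); split=> //; last first.
  by move=> j lt_j; rewrite /upd s1s'.
have -> : r 0 = (run p x h).2 0 by rewrite run_h.
by apply: urm_fun_halted; rewrite /halted run_h -onthNE at_i.
Qed.

Lemma urm_edgeI i e : i < T -> e \in urm_edges k T A sa p i ->
  E e.1.1 e.1.2 e.2.
Proof. by case: e => [[u c] v] lt_i e; exists i. Qed.

(* [base] is the node of one of the two waiting loops of the jump at [i]; the
   loop raises the scratch variable from [r j + 1] to [r j']. *)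
Lemma urm_wait base i j j' s :
  E (k + i) (AssignSucc A (A.+1 + j)) base -> E base (AssignSucc A A) base ->
  E base (GuardVar A (A.+1 + j')) (k + i.+1) ->
  s (A.+1 + j) < s (A.+1 + j') -> reach E k J (k + i) s ->
  reach E k J (k + i.+1) (upd s A (s (A.+1 + j'))).
Proof.
move=> e1 e2 e3 lt_s us.
have wait d : reach E k J base (upd s A ((s (A.+1 + j)).+1 + d)).
  elim: d => [|d IH]; first by rewrite addn0; apply: reach_edge us e1 _.
  apply: reach_edge IH e2 _; congr Some; apply/funext => h.
  by rewrite /upd eqxx addnS; case: eqP.
have := wait (s (A.+1 + j') - (s (A.+1 + j)).+1); rewrite subnKC // => us'.
apply: reach_edge us' e3 _; rewrite /= upd_same upd_other ?eqxx //; lia.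
Qed.

Lemma urm_complete s1 h : J s1 -> exists s,
  [/\ (run p x h).1 < T, reach E k J (k + (run p x h).1) s,
      holds_regs A K (run p x h).2 s & agree A s1 s].
Proof.
move=> Js1; elim: h => [|h [s [lt_i us rs s1s]]].
  exists s1; rewrite /= addn0; split=> //; first by lia.
    exact: reach_start.
  exact: J_regs.
have -> : run p x h.+1 = step p (run p x h) by [].
case: (run p x h) lt_i us rs => i r /= lt_i us rs.
(* A halted configuration is repeated by [step], so the same state serves again. *)
case at_i: (onth p i) => [ins|]; last by exists s.
have lt_i1 := onth_lt at_i; have := p_bounded at_i.
have eI e := urm_edgeI (i := i) (e := e) lt_i; rewrite /urm_edges at_i in eI.
case: ins at_i eI => [n|n|n1 n2|n1 n2 q] at_i eI /=.
- move=> lt_n; exists (upd s (A.+1 + n) 0); split=> //.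
  + by apply: reach_edge us (eI _ (mem_head _ _)) _.
  + exact: holds_regs_upd.
  + by apply: agree_upd => //; lia.
- move=> lt_n; exists (upd s (A.+1 + n) (r n).+1); split=> //.
  + by apply: reach_edge us (eI _ (mem_head _ _)) _; rewrite /= rs.
  + exact: holds_regs_upd.
  + by apply: agree_upd => //; lia.
- case/andP=> lt1 lt2; exists (upd s (A.+1 + n2) (r n1)); split=> //.
  + by apply: reach_edge us (eI _ (mem_head _ _)) _; rewrite /= rs.
  + exact: holds_regs_upd.
  + by apply: agree_upd => //; lia.
case/and3P=> lt1 lt2 lt_q; case: eqP => [eq12|neq12].
  exists s; split=> //.
  by apply: reach_edge us (eI _ (mem_head _ _)) _; rewrite /= !rs // eq12 eqxx.
have [lt12|le21] := ltnP (r n1) (r n2).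
  exists (upd s A (s (A.+1 + n2))); split=> //.
  - apply: (@urm_wait (k + T + i) i n1 n2); rewrite ?rs //.
    + by apply: (eI (_, _, _)); rewrite !inE eqxx ?orbT.
    + by apply: (eI (_, _, _)); rewrite !inE eqxx ?orbT.
    + by apply: (eI (_, _, _)); rewrite !inE eqxx ?orbT.
  - exact: holds_regs_low.
  - exact: agree_upd.
exists (upd s A (s (A.+1 + n1))); split=> //.
- apply: (@urm_wait (k + 2 * T + i) i n2 n1); rewrite ?rs //; last by lia.
  + by apply: (eI (_, _, _)); rewrite !inE eqxx ?orbT.
  + by apply: (eI (_, _, _)); rewrite !inE eqxx ?orbT.
  + by apply: (eI (_, _, _)); rewrite !inE eqxx ?orbT.
- exact: holds_regs_low.
- exact: agree_upd.
Qed.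

Lemma urm_exit s1 z : J s1 -> urm_fun p x = Some z ->
  exists2 s, reach E k J sa s & agree A (upd s1 0 z) s.
Proof.
move=> Js1 /urm_fun_Some[h halt_h <-].
have [s [lt_i us rs s1s]] := urm_complete h Js1.
exists (upd s 0 (s A.+1)); last first.
  by move=> j lt_j; rewrite /upd -[A.+1]addn0 rs // s1s.
apply: (reach_edge (c := AssignVar 0 A.+1) us) => //.
exists (run p x h).1 => //; move: halt_h; rewrite /halted -onthNE /urm_edges.
by case: onth => // _; rewrite mem_head.
Qed.

End Simulation.

(** * Bounds on the indices inside codes *)

Lemma leq_npair n1 n2 : n1 <= npair n1 n2 /\ n2 <= npair n1 n2.
Proof.
rewrite /npair; have := ltn_expl n1 (isT : 1 < 2); move: (2 ^ n1) => h lt_h.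
by split; nia.
Qed.

Lemma mem_decode l z : z \in CodeSeq.decode l -> z < l.
Proof.
by move=> zl; have /allP/(_ z zl) := CodeSeq.ltn_code (CodeSeq.decode l);
  rewrite CodeSeq.decodeK.
Qed.

Lemma instr_code_bounded ins b K T : instr_code ins <= b -> b < K -> b < T ->
  instr_bounded K T ins.
Proof.
case: ins => [n|n|n1 n2|n1 n2 q] /= le_b lt_K lt_T; try lia.
- by have := leq_npair n1 n2; lia.
- by have := leq_npair n1 n2; have := leq_npair (npair n1 n2) q; lia.
Qed.

Lemma onth_RM b i : onth (RM b) i =
  if size (CodeSeq.decode b.+1) <= i then None
  else Some (instr_decode (CodeSeq.decode b.+1)$i).
Proof.
by rewrite /RM; elim: (CodeSeq.decode b.+1) i => [|z l IH] [|i] //=.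
Qed.

(** Entries of a list are below its code and the indices in an instruction are at most its code, so
    every register and jump target of [RM b] is at most [b]. *)
Lemma RM_bounded b K T i ins : b < K -> b < T ->
  onth (RM b) i = Some ins -> instr_bounded K T ins.
Proof.
move=> lt_K lt_T; rewrite onth_RM; case: leqP => // lt_i [<-].
apply: instr_code_bounded lt_K lt_T; rewrite instr_decodeK -ltnS.
exact/mem_decode/mem_nth.
Qed.

Lemma size_RM b : size (RM b) <= b.+1.
Proof. by rewrite size_map -{2}[b.+1]CodeSeq.decodeK size_le_code. Qed.

Lemma com_nvars_code c : com_nvars c <= (com_code c).+1.
Proof.
case: c => [i|i j|i j|i j|i v] /=; try by have := leq_npair i j; lia.
  by lia.
by have := leq_npair i v; lia.
Qed.

(** The code also bounds the variables of a graph: those from [a.+1] on are invisible to graph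
    [a]. *)
Lemma gedge_nvars a u c v : gedge a u c v -> com_nvars c <= a.+1.
Proof.
move=> [z zL [_ -> _]]; apply: leq_trans (com_nvars_code _) _.
rewrite com_decodeK ltnS; apply: leq_trans (leq_div _ _) _.
apply: leq_trans (leq_div _ _) _; apply: leq_trans (ltnW (mem_decode zL)) _.
apply: leq_trans (leq_div _ _) _; apply: leq_trans (leq_div _ _) _.
by have := leq_npair (nunpair a).1 (nunpair a).2; rewrite nunpairK => -[].
Qed.

(** The match on the decoded instruction becomes a sequence of tests on the residue of its code
    modulo 4, and its operands become iterated unpairings of the quotient. *)
Lemma pre_urm_edges D k T A sa b i : pr D -> pr k -> pr T -> pr A -> pr sa ->
  pr b -> pr i -> pre D (fun e =>
    urm_edges (k e) (T e) (A e) (sa e) (RM (b e)) (i e)).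
Proof.
move=> pD pk pT pA psa pb pi.
pose z e := (CodeSeq.decode (b e).+1)$(i e).
have pz : pr z by rewrite /z; pr_tac.
pose w e := z e %/ 4; have pw : pr w by rewrite /w; pr_tac.
pose w1 e := (nunpair (w e)).1; have pw1 : pr w1 by rewrite /w1; pr_tac.
pose w2 e := (nunpair (w e)).2; have pw2 : pr w2 by rewrite /w2; pr_tac.
pose w11 e := (nunpair (w1 e)).1; have pw11 : pr w11 by rewrite /w11; pr_tac.
pose w12 e := (nunpair (w1 e)).2; have pw12 : pr w12 by rewrite /w12; pr_tac.
suff : pre D (fun e =>
  if size (CodeSeq.decode (b e).+1) <= i e then
    [:: (k e + i e, AssignVar 0 (A e).+1, sa e)]
  else if z e %% 4 == 0 then
    [:: (k e + i e, AssignZero ((A e).+1 + w e), k e + (i e).+1)]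
  else if z e %% 4 == 1 then
    [:: (k e + i e, AssignSucc ((A e).+1 + w e) ((A e).+1 + w e),
         k e + (i e).+1)]
  else if z e %% 4 == 2 then
    [:: (k e + i e, AssignVar ((A e).+1 + w2 e) ((A e).+1 + w1 e),
         k e + (i e).+1)]
  else
    [:: (k e + i e, GuardVar ((A e).+1 + w11 e) ((A e).+1 + w12 e), k e + w2 e);
        (k e + i e, AssignSucc (A e) ((A e).+1 + w11 e), k e + T e + i e);
        (k e + T e + i e, AssignSucc (A e) (A e), k e + T e + i e);
        (k e + T e + i e, GuardVar (A e) ((A e).+1 + w12 e), k e + (i e).+1);
        (k e + i e, AssignSucc (A e) ((A e).+1 + w12 e), k e + 2 * T e + i e);
        (k e + 2 * T e + i e, AssignSucc (A e) (A e), k e + 2 * T e + i e);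
        (k e + 2 * T e + i e, GuardVar (A e) ((A e).+1 + w11 e),
         k e + (i e).+1)]).
  move=> pE; apply: (eq_pr pE) => e; congr (CodeSeq.code (map _ _)).
  rewrite /urm_edges onth_RM -/(z e); case: leqP => // _.
  rewrite /w12 /w11 /w2 /w1 /instr_decode -/(w e).
  by case: (z e %% 4) => [|[|[|r]]].
by pr_tac.
Qed.

(** * The graph for strong smn *)

Definition smn_com n A (X : seq nat) j :=
  if j < n then AssignVar (n - j) (n - j.+1)
  else GuardCst (A.+1 + (j - n)) X$(j - n).

(* The prelude shifts the n inputs by one place, and its guards initialise the
   registers A + 1, ..., A + b + m + 1 of the simulated URM: these variables
   are unconstrained at the start node. *)
Definition smn_graph t n m a b X :=
  let k := gsize a in let T := b.+2 in let A := a + (t + n).+2 in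
  let N := n + (b + m.+1) in let C := k + 3 * T in let D := C + N.+1 in
  mk_graph D (copy_graph a D 0 (collect T (fun i =>
      map (ecode D) (urm_edges k T A (gstart a) (RM b) i))
    (chain_list D C N (smn_com n A X) [::] k))) C (gstop a).

Lemma pr_smn t n m : pr (fun e => smn_graph t n m e$0 e$1 (CodeSeq.decode e$2)).
Proof.
apply: pr_mk_graph; [by pr_tac|apply: prl_copy; try by pr_tac|by pr_tac|by pr_tac].
pose D a b := gsize a + 3 * b.+2 + (n + (b + m.+1)).+1.
apply: (prl_collect (N := fun e => (e$1).+2)
  (F := fun e => map (ecode (D e$2 e$3))
     (urm_edges (gsize e$2) (e$3).+2 (e$2 + (t + n).+2) (gstart e$2)
       (RM e$3) e$0))
  (G := fun e => chain_list (D e$0 e$1) (gsize e$0 + 3 * (e$1).+2)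
     (n + (e$1 + m.+1)) (smn_com n (e$0 + (t + n).+2) (CodeSeq.decode e$2)) [::]
     (gsize e$0))) => //; first by pr_tac.
  by apply: (pre_urm_edges (D := fun e => D e$2 e$3) (k := fun e => gsize e$2)
    (T := fun e => (e$3).+2) (A := fun e => e$2 + (t + n).+2)
    (sa := fun e => gstart e$2) (b := fun e => e$3) (i := fun e => e$0));
    rewrite ?/D; pr_tac.
apply: (prl_collect (N := fun e => n + (e$1 + m.+1))
  (F := fun e => map (ecode (D e$2 e$3))
     [:: (gsize e$2 + 3 * (e$3).+2 + e$0,
          smn_com n (e$2 + (t + n).+2) (CodeSeq.decode e$4) e$0,
          gsize e$2 + 3 * (e$3).+2 + (e$0).+1)])) => //; first by pr_tac.
  by rewrite /smn_com /D; pr_tac.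
by rewrite /D; pr_tac.
Qed.

(** Three layers of nodes: the copy of [a] below [k], the simulator from [k] to [C], the prelude
    from [C] on. The prelude is left only to [k] and the simulator only to [gstart a], so
    [reach_low] cuts a run twice. *)
Lemma smn_outcome t n m a b (x : m.-tuple nat) y s :
  let k := gsize a in let T := b.+2 in let A := a + (t + n).+2 in
  let N := n + (b + m.+1) in let C := k + 3 * T in
  outcome (smn_graph t n m a b x) y s <->
  reach (gedge a) (gstart a)
    (reach (urm_edge k T A (gstart a) (RM b)) k
      (reach (chain_edge C N (smn_com n A x) (fun=> False) k)
        C (starts_with y) k) (gstart a)) (gstop a) s.
Proof.
move=> k T A N C; have lt_sa : gstart a < k := gstart_lt a.
have urm_lt u c v : urm_edge k T A (gstart a) (RM b) u c v ->
    k <= u < k + 3 * T /\ (k <= v < k + 3 * T \/ v = gstart a).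
  apply: (@urm_edge_lt _ _ _ _ (b + m.+1)) => //; try exact: size_RM.
    by lia.
  by move=> i ins; apply: RM_bounded; lia.
have lt_kC : k < C by lia.
pose Ch := chain_edge C N (smn_com n A x) (fun=> False) k.
rewrite /smn_graph -/k -/T -/A -/N -/C (outcome_mk (E := fun u c v =>
  (Ch u c v \/ urm_edge k T A (gstart a) (RM b) u c v) \/ gedge a u c v));
  first last.
- move=> u c v [[/(chain_edge_lt lt_kC)|/urm_lt]|/gedge_lt]; lia.
- move=> z; rewrite (represents_copy _ _ (represents_collect _ _
    (represents_chain _ _ _ _ _ _))).
  split=> -[u [c [v [e ->]]]]; exists u, c, v; split=> //.
    case: e => [[e|]|/gedge0]; [|by left; right|by right].
    by left; left; case: e => [[eq_u [|[]]]|]; [left; split=> //; left | | right].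
  case: e => [[e|]|/gedge0]; [|by left; right|by right].
  by left; left; case: e => [[eq_u [|[]]]|]; [left; split=> //; left | | right].
- by have := gstop_lt a; lia.
- by lia.
rewrite (@reach_low k _ _ (gstart a)) //; first last.
- exact: gstop_lt.
- by lia.
- by move=> u c v [/(chain_edge_lt lt_kC)|/urm_lt]; lia.
- exact: gedge_lt.
have eqJ r : reach (fun u c v => Ch u c v \/
      urm_edge k T A (gstart a) (RM b) u c v) C (starts_with y) (gstart a) r <->
    reach (urm_edge k T A (gstart a) (RM b)) k (reach Ch C (starts_with y) k)
      (gstart a) r.
  apply: (@reach_low C); try lia.
    by move=> u c v /urm_lt; lia.
  by move=> u c v /(chain_edge_lt lt_kC); lia.
by split; apply: eq_reach => // r /eqJ.
Qed.

(** The shift runs from the top down, so each input is read before it is overwritten. Past the [m]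
    inputs the guards compare with the default 0 of [nth], the initial content of the remaining
    registers. *)
Lemma smn_prelude_sound n m b A C k (x : m.-tuple nat) (y : n.-tuple nat) s :
  n < A -> k < C ->
  reach (chain_edge C (n + (b + m.+1)) (smn_com n A x) (fun=> False) k)
    C (starts_with y) k s ->
  (forall i, i < n -> s i.+1 = (tval y)$i) /\
  holds_regs A (b + m.+1) (fun i => nth 0 x i) s.
Proof.
move=> lt_nA lt_kC us.
pose P j (s : regs) := [/\ forall i, i < n -> i <= n - j -> s i = (tval y)$i,
  forall i, i < n -> n - j <= i -> s i.+1 = (tval y)$i &
  forall i, i < j - n -> s (A.+1 + i) = (tval x)$i].
suff [_ P2 P3] : P (n + (b + m.+1)) s.
  by split=> [i lt_i|i lt_i]; [apply: P2 => //; lia | apply: P3; lia].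
apply: (chain_sound lt_kC _ _ _ us) => //.
- by move=> r yr; split=> [i lt_i _|i|i]; try lia; rewrite yr ?size_tuple.
- rewrite /smn_com => j r r' lt_j [P1 P2 P3]; case: ltnP => [lt_jn|le_nj] /=.
    case=> <-; split=> [i lt_i le_i|i lt_i le_i|i]; last by lia.
      by rewrite upd_other; [apply: P1; lia | lia].
    rewrite /upd; case: eqP => [eq_i|neq_i]; last by apply: P2; lia.
    have -> : n - j.+1 = i by lia.
    by apply: P1; lia.
  case: eqP => // eq_j [<-]; split=> [i lt_i le_i|i lt_i le_i|i lt_i].
  - by apply: P1; lia.
  - by apply: P2; lia.
  - have [lt|ge] := ltnP i (j - n); first exact: P3.
    by have -> : i = j - n by lia.
Qed.

Lemma smn_prelude_complete n m b A C k (x : m.-tuple nat) (y : n.-tuple nat) s :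
  n < A -> (forall i, i < n -> s i.+1 = (tval y)$i) ->
  exists2 r, reach (chain_edge C (n + (b + m.+1)) (smn_com n A x) (fun=> False) k)
    C (starts_with y) k r & forall i, 0 < i < A -> r i = s i.
Proof.
move=> lt_nA sy.
(* [f0] is [s] with the variables above [A] preset to what the guards demand; they are free at the
   start. [f j] is the state after [j] commands: positions up to [n - j] still hold their inputs
   unshifted. *)
pose f0 i := if i <= A then s i else (tval x)$(i - A.+1).
pose f j i := if (i <= n - j) && (i < n) then f0 i.+1 else f0 i.
exists (f (n + (b + m.+1))); last first.
  move=> i /andP[i_gt0 lt_i]; rewrite /f /f0.
  by have -> : i <= n - (n + (b + m.+1)) = false; [lia | rewrite /= ltnW].
apply/chain_exit/chain_run => //.
  move=> i; rewrite size_tuple => lt_i; rewrite /f subn0 ltnW // lt_i /f0.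
  by rewrite sy //; case: leqP => //; lia.
move=> j lt_j; rewrite /smn_com; case: ltnP => [lt_jn|le_nj] /=.
  congr Some; apply/funext => i; rewrite /upd; case: eqP => [->|neq_i].
    rewrite /f; have -> : n - j.+1 <= n - j by lia.
    have -> : n - j.+1 < n by lia.
    have -> : n - j <= n - j.+1 = false by lia.
    by rewrite /=; congr f0; lia.
  rewrite /f; have -> // : (i <= n - j) = (i <= n - j.+1) by lia.
have -> : f j (A.+1 + (j - n)) = (tval x)$(j - n).
  rewrite /f /f0; have -> : A.+1 + (j - n) < n = false by lia.
  rewrite andbF; have -> : A.+1 + (j - n) <= A = false by lia.
  by rewrite addKn.
rewrite eqxx; congr Some; apply/funext => i; rewrite /f.
by have -> : n - j = n - j.+1 by lia.
Qed.

Lemma prl_map_nth l : prl (fun e => [seq e$i | i <- l]).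
Proof.
elim: l => [|i l IH]; first exact: prl_nil.
exact: prl_cons (pr_nth i) IH.
Qed.

Lemma strong_smn_state t (Q : set (set (t.-tuple nat))) :
  strong_smn (state_semantics Q).
Proof.
move=> m n m_gt0 n_gt0.
pose f e := smn_graph t n m e$0 e$1 [seq e$i | i <- iota 2 m].
exists (fun e : m.+2.-tuple nat => f e); split.
  apply: pr_computable.
  apply: (eq_pr (pr_comp3
    (F := fun a b l => smn_graph t n m a b (CodeSeq.decode l))
    (pr_smn t n m) (pr_nth 0) (pr_nth 1) (prl_map_nth (iota 2 m)))) => e.
  by rewrite CodeSeq.codeK.
move=> a b x; apply/funext => y.
have -> : f [tuple of [:: a, b & x]] = smn_graph t n m a b x.
  rewrite /f /=; congr smn_graph; rewrite -[RHS](mkseq_nth 0) size_tuple.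
  by rewrite /mkseq (iotaDl 2 0) -map_comp.
(* [A] exceeds [n], the last position of the shifted inputs, and [t], so that [Q] never sees the
   simulation, and it is above every variable of graph [a]. *)
set A := a + (t + n).+2; have lt_nA : n < A by lia.
pose C := gsize a + 3 * b.+2; have lt_C : gsize a < C by lia.
pose J1 := reach (chain_edge C (n + (b + m.+1)) (smn_com n A x)
  (fun=> False) (gsize a)) C (starts_with y) (gsize a).
pose J := reach (urm_edge (gsize a) b.+2 A (gstart a) (RM b)) (gsize a) J1
  (gstart a).
have outJ s : outcome (smn_graph t n m a b x) y s <->
  reach (gedge a) (gstart a) J (gstop a) s by apply: smn_outcome.
have J1_regs s : J1 s -> holds_regs A (b + m.+1) (fun i => nth 0 x i) s.
  by case/(smn_prelude_sound lt_nA lt_C).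
have bounded i ins : onth (RM b) i = Some ins ->
  instr_bounded (b + m.+1) b.+2 ins by apply: RM_bounded; lia.
have K_gt0 : 0 < b + m.+1 by lia.
have size_lt : size (RM b) < b.+2 := size_RM b.
have J_sound r : J r -> exists2 z, phi m b x = Some z & starts_with (z :: y) r.
  move=> /(urm_sound (gstart_lt a) size_lt K_gt0 bounded J1_regs).
  case=> [|s1 [z [/(smn_prelude_sound lt_nA lt_C)[s1y _] phi_z s1r]]]; first by lia.
  exists z => // i /=; rewrite ltnS size_tuple => lt_i; rewrite -s1r; last by lia.
  by case: i lt_i => [|i] lt_i; rewrite ?upd_same // upd_other // s1y.
(* If [phi] is undefined, no run gets out of the simulator and the stop node has no state. *)
case phi_x: (phi m b x) => [z|]; last first.
  apply/esym/state_den_None => s /outJ.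
  by elim=> // r /J_sound[z]; rewrite phi_x.
apply: eq_state_den => s os.
  (* From [A] on, the simulation fixes variables that a direct run of [a] leaves arbitrary, so the
     run is transported only up to agreement below [A]. *)
  have [||r ur sr] := reach_agree (k := A) (J := J) _ _ os.
  - by move=> u c v /gedge_nvars; lia.
  - move=> s0 zs0; have s0y i : i < n -> s0 i.+1 = (tval y)$i.
      by move=> lt_i; rewrite (zs0 i.+1) //= ltnS size_tuple.
    have [s1 J1s1 s1s0] := smn_prelude_complete b C (gsize a) x lt_nA s0y.
    have [r Jr s1r] := urm_exit (gstart_lt a) size_lt K_gt0 bounded J1_regs
      J1s1 phi_x.
    exists r => // i lt_i; rewrite -s1r //; case: i lt_i => [|i] lt_i.
      by rewrite upd_same (zs0 0).
    by rewrite upd_other // s1s0.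
  - exists r; first exact/outJ.
    by move=> i lt_i; apply: sr; lia.
(* Conversely, every state leaving the simulator is an initial state of [a] on [z :: y], so the same
   final state serves. *)
exists s => //; move/outJ: os; apply: eq_reach => // r /J_sound[z'].
by rewrite phi_x => -[<-].
Qed.

Theorem mainTheorem10 (t : nat) (Q : set (set (t.-tuple nat))) :
  strong_smn (state_semantics Q) /\
  branching (state_semantics Q) /\
  discharging (state_semantics Q).
Proof.
split; first exact: strong_smn_state.
by split; [exact: branching_state | exact: discharging_state].
Qed.
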